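(* Let $\mathcal{C}$ be a triangulated category endowed with a weight structure $w$, let $H$ be a cohomological functor from $\mathcal{C}$ into an abelian category $A$, let $m,n\in\mathbb{Z}$ and $M\in\mathrm{Obj}\,\mathcal{C}$. Then the following statements are valid. 1. The functor $\tau^{\ge -n}(H)$ is of weight range $\le n$, and $\tau^{\le -m}(H)$ is of weight range $\ge m$. 2. Assume that $w$ is bounded. Then $H$ is of weight range $\le n$ (resp. of weight range $\ge m$) if and only if it kills $\mathcal{C}_{w=i}$ for all $i>n$ (resp. for all $i<m$). 3. $\tau^{\ge -n}(H)\cong H$ (resp. $\tau^{\le -m}(H)\cong H$) if and only if $H$ is of weight range $\le n$ (resp. of weight range $\ge m$). 4. $\tau^{\ge -n}(\tau^{\le -m}(H))\cong\tau^{\le -m}(\tau^{\ge -n}(H))$. 5. If $H$ is of weight range $\ge m$ then $\tau^{\ge -n}(H)$ is of weight range $[m,n]$. 6. Dually, if $H$ is of weight range $\le n$ then $\tau^{\le -m}(H)$ is of weight range $[m,n]$. 7. Assume that $m>n$. Then the only functors of weight range $[m,n]$ are zero ones; thus if $H$ is of weight range $\le n$ (resp. $\ge m$) then $\tau^{\le -m}(H)=0$ (resp. $\tau^{\ge -n}(H)=0$). 8. The (cohomological) functors of weight range $[m,m]$ from $\mathcal{C}$ into $A$ are exactly those of the form $H_{\mathcal{A}}\circ[-m]$, where $\mathcal{A}:\underline{Hw}^{op}\to A$ is an additive functor. 9. The (representable) functor $H_M=\mathcal{C}(-,M):\mathcal{C}^{op}\to\mathrm{Ab}$ is of weight range $\ge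 m$ if and only if $M\in\mathcal{C}_{w\ge m}$. 10. If $H$ is of weight range $[m,n]$ then the morphism $H(w_{\ge m}M)\to H(M)$ is surjective and the morphism $H(M)\to H(w_{\le n}M)$ is injective (for arbitrary choices of the corresponding weight decompositions of $M$).
   Context: Weight structures: a pair $(\mathcal{C}_{w\le 0},\mathcal{C}_{w\ge 0})$ of classes of objects such that: (i) both are closed under retracts in $\mathcal{C}$; (ii) $\mathcal{C}_{w\le 0}\subset \mathcal{C}_{w\le 0}[1]$ and $\mathcal{C}_{w\ge 0}[1]\subset \mathcal{C}_{w\ge 0}$; (iii) $\mathcal{C}(X,Y)=0$ for $X\in\mathcal{C}_{w\le 0}$, $Y\in \mathcal{C}_{w\ge 0}[1]$; (iv) every object $M$ fits in a distinguished triangle $LM\to M\to RM\to LM[1]$ with $LM\in\mathcal{C}_{w\le 0}$, $RM\in \mathcal{C}_{w\ge 0}[1]$. Put $\mathcal{C}_{w\le i}=\mathcal{C}_{w\le 0}[i]$, $\mathcal{C}_{w\ge i}=\mathcal{C}_{w\ge 0}[i]$, $\mathcal{C}_{w=i}=\mathcal{C}_{w\le i}\cap\mathcal{C}_{w\ge i}$. The heart $\underline{Hw}$ is the full subcategory on $\mathcal{C}_{w=0}$. $w$ is bounded if $\bigcup_i\mathcal{C}_{w\le i}=\mathrm{Obj}\,\mathcal{C}=\bigcup_i\mathcal{C}_{w\ge i}$. For each $i$ choose distinguished triangles ($i$-weight decompositions) $w_{\le i}M\to M\to w_{\ge i+1}M\to$ with $w_{\le i}M\in\mathcal{C}_{w\le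 i}$, $w_{\ge i+1}M\in\mathcal{C}_{w\ge i+1}$; for $i<j$ there is a unique morphism over $\mathrm{id}_M$ from the $i$-th triangle to the $j$-th one. The virtual $t$-truncations of $H$ are the cohomological functors $\tau^{\ge -n}(H)(M)=\mathrm{Im}(H(w_{\le n+1}M)\to H(w_{\le n}M))$ and $\tau^{\le -n}(H)(M)=\mathrm{Im}(H(w_{\ge n}M)\to H(w_{\ge n-1}M))$ (well defined and independent of choices). $H$ is of weight range $\ge m$ (resp. $\le n$, resp. $[m,n]$) if it annihilates $\mathcal{C}_{w\le m-1}$ (resp. $\mathcal{C}_{w\ge n+1}$, resp. both of these classes). Pure cohomological functors: for $M\in\mathrm{Obj}\,\mathcal{C}$ choose distinguished triangles $w_{\le i-1}M\to w_{\le i}M\to M_i\to w_{\le i-1}M[1]$ and put $M^p=M_{-p}[p]\in\mathrm{Obj}\,\underline{Hw}$, with differential $M^p\to M^{p+1}$ the shift by $[p]$ of $M_{-p}\to w_{\le -p-1}M[1]\to M_{-p-1}[1]$; $(M^p)$ is a weight complex of $M$. For an additive functor $\mathcal{A}:\underline{Hw}^{op}\to A$, $H_{\mathcal{A}}(M)$ is the homology at $\mathcal{A}(M^0)$ of the complex obtained by applying $\mathcal{A}$ to $(M^p)$; this gives a cohomological functor from $\mathcal{C}$ into $A$ independent of choices. *)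

(* Defs.v *)
(* The classical axioms of boolp are used to choose images,
   kernels, cokernels and morphisms of triangles, which are unique only up to
   isomorphism or are given by an existence statement. *)
From HB Require Import structures.
From mathcomp Require Import all_boot all_order all_algebra.
From mathcomp Require Import boolp.

Set Implicit Arguments.
Unset Strict Implicit.
Unset Printing Implicit Defensive.

Import Order.TTheory GRing.Theory Num.Theory.
Local Open Scope ring_scope.

Record precat := PreCat {
  obj :> Type;
  Hom : obj -> obj -> zmodType;
  idm : forall X, Hom X X;
  comp : forall X Y Z, Hom Y Z -> Hom X Y -> Hom X Z;
  compA : forall W X Y Z (h : Hom Y Z) (g : Hom X Y) (f : Hom W X),
    comp h (comp g f) = comp (comp h g) f;
  comp1m : forall X Y (f : Hom X Y), comp (idm Y) f = f;
  compm1 : forall X Y (f : Hom X Y), comp f (idm X) = f;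
  compDl : forall X Y Z (g g' : Hom Y Z) (f : Hom X Y),
    comp (g + g') f = comp g f + comp g' f;
  compDr : forall X Y Z (g : Hom Y Z) (f f' : Hom X Y),
    comp g (f + f') = comp g f + comp g f' }.

Arguments Hom {p} X Y.
Arguments idm {p} X.
Arguments comp {p X Y Z} g f.

Notation "g ∘ f" := (comp g f) (at level 40, left associativity) : ring_scope.

Section PrecatDefs.
Variable C : precat.
Implicit Types X Y Z K Q I : C.

Definition zero_obj X : Prop :=
  (forall Y (f : Hom X Y), f = 0) /\ (forall Y (f : Hom Y X), f = 0).

Definition mono X Y (f : Hom X Y) : Prop :=
  forall W (u v : Hom W X), f ∘ u = f ∘ v -> u = v.

Definition epi X Y (f : Hom X Y) : Prop :=
  forall W (u v : Hom Y W), u ∘ f = v ∘ f -> u = v.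

Definition is_iso X Y (f : Hom X Y) : Prop :=
  exists g : Hom Y X, g ∘ f = idm X /\ f ∘ g = idm Y.

Definition isom X Y : Prop := exists f : Hom X Y, is_iso f.

Definition retract X Y : Prop :=
  exists (s : Hom X Y) (r : Hom Y X), r ∘ s = idm X.

Definition is_kernel K Y Z (g : Hom Y Z) (k : Hom K Y) : Prop :=
  g ∘ k = 0 /\
  forall W (u : Hom W Y), g ∘ u = 0 -> exists! v : Hom W K, k ∘ v = u.

Definition is_cokernel X Y Q (f : Hom X Y) (q : Hom Y Q) : Prop :=
  q ∘ f = 0 /\
  forall W (u : Hom Y W), u ∘ f = 0 -> exists! v : Hom Q W, v ∘ q = u.

Definition is_image X Y I (f : Hom X Y) (i : Hom I Y) : Prop :=
  exists Q (q : Hom Y Q), is_cokernel f q /\ is_kernel q i.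

Definition exact_at X Y Z (f : Hom X Y) (g : Hom Y Z) : Prop :=
  exists I (i : Hom I Y), is_image f i /\ is_kernel g i.

Definition has_biproducts : Prop := forall X Y,
  exists P (i1 : Hom X P) (i2 : Hom Y P) (p1 : Hom P X) (p2 : Hom P Y),
    [/\ p1 ∘ i1 = idm X, p2 ∘ i2 = idm Y, p1 ∘ i2 = 0, p2 ∘ i1 = 0
      & i1 ∘ p1 + i2 ∘ p2 = idm P].

Definition additive_cat : Prop := (exists Z, zero_obj Z) /\ has_biproducts.

End PrecatDefs.

Record abcat := AbCat {
  ab_cat :> precat;
  ab_additive : additive_cat ab_cat;
  ab_ker : forall (X Y : ab_cat) (f : Hom X Y),
    exists K (k : Hom K X), is_kernel f k;
  ab_coker : forall (X Y : ab_cat) (f : Hom X Y),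
    exists Q (q : Hom Y Q), is_cokernel f q;
  ab_mono : forall (X Y : ab_cat) (f : Hom X Y),
    mono f -> exists Z (g : Hom Y Z), is_kernel g f;
  ab_epi : forall (X Y : ab_cat) (f : Hom X Y),
    epi f -> exists Z (g : Hom Z X), is_cokernel g f }.

Record functor (C D : precat) := Functor {
  fobj :> C -> D;
  fmap : forall X Y, Hom X Y -> Hom (fobj X) (fobj Y);
  fmap1 : forall X, fmap (idm X) = idm (fobj X);
  fmapM : forall X Y Z (g : @Hom C Y Z) (f : Hom X Y),
    fmap (g ∘ f) = fmap g ∘ fmap f;
  fmapD : forall X Y (f g : @Hom C X Y), fmap (f + g) = fmap f + fmap g }.

Arguments fmap {C D} f0 {X Y} f : rename.

Definition fid (C : precat) : functor C C :=
  @Functor C C id (fun _ _ f => f) (fun _ => erefl)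
    (fun _ _ _ _ _ => erefl) (fun _ _ _ _ => erefl).

Section FunctorComp.
Variables (C D E : precat) (G : functor D E) (F : functor C D).

Fact fcomp_1 X : fmap G (fmap F (idm X)) = idm (G (F X)).
Proof. by rewrite !fmap1. Qed.
Fact fcomp_M X Y Z (g : @Hom C Y Z) (f : Hom X Y) :
  fmap G (fmap F (g ∘ f)) = fmap G (fmap F g) ∘ fmap G (fmap F f).
Proof. by rewrite !fmapM. Qed.
Fact fcomp_D X Y (f g : @Hom C X Y) :
  fmap G (fmap F (f + g)) = fmap G (fmap F f) + fmap G (fmap F g).
Proof. by rewrite !fmapD. Qed.

Definition fcomp : functor C E :=
  @Functor C E (fun X => G (F X)) (fun _ _ f => fmap G (fmap F f))
    fcomp_1 fcomp_M fcomp_D.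
End FunctorComp.

Fixpoint fiter (C : precat) (k : nat) (F : functor C C) : functor C C :=
  if k is k'.+1 then fcomp F (fiter k' F) else fid C.

Record nat_iso (C D : precat) (F G : functor C D) := NatIso {
  ni_map :> forall X : C, Hom (F X) (G X);
  ni_iso : forall X, is_iso (ni_map X);
  ni_nat : forall X Y (f : Hom X Y), ni_map Y ∘ fmap F f = fmap G f ∘ ni_map X }.

(* Additive functors C^op -> D. *)
Record cofunctor (C D : precat) := CoFunctor {
  cobj :> C -> D;
  cmap : forall X Y, Hom X Y -> Hom (cobj Y) (cobj X);
  cmap1 : forall X, cmap (idm X) = idm (cobj X);
  cmapM : forall X Y Z (g : @Hom C Y Z) (f : Hom X Y),
    cmap (g ∘ f) = cmap f ∘ cmap g;
  cmapD : forall X Y (f g : @Hom C X Y), cmap (f + g) = cmap f + cmap g }.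

Arguments cmap {C D} c {X Y} f : rename.

Section CofunctorComp.
Variables (C D E : precat) (H : cofunctor D E) (F : functor C D).

Fact ccomp_1 X : cmap H (fmap F (idm X)) = idm (H (F X)).
Proof. by rewrite fmap1 cmap1. Qed.
Fact ccomp_M X Y Z (g : @Hom C Y Z) (f : Hom X Y) :
  cmap H (fmap F (g ∘ f)) = cmap H (fmap F f) ∘ cmap H (fmap F g).
Proof. by rewrite fmapM cmapM. Qed.
Fact ccomp_D X Y (f g : @Hom C X Y) :
  cmap H (fmap F (f + g)) = cmap H (fmap F f) + cmap H (fmap F g).
Proof. by rewrite fmapD cmapD. Qed.

Definition ccomp : cofunctor C E :=
  @CoFunctor C E (fun X => H (F X)) (fun _ _ f => cmap H (fmap F f))
    ccomp_1 ccomp_M ccomp_D.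
End CofunctorComp.

Definition cofunctor_iso (C D : precat) (F G : cofunctor C D) : Prop :=
  exists a : forall X : C, Hom (F X) (G X),
    (forall X, is_iso (a X)) /\
    (forall X Y (f : Hom X Y), a X ∘ cmap F f = cmap G f ∘ a Y).

Definition kills (C D : precat) (H : cofunctor C D) (P : C -> Prop) : Prop :=
  forall X, P X -> zero_obj (H X).

Definition cofunctor_zero (C D : precat) (H : cofunctor C D) : Prop :=
  forall X, zero_obj (H X).

Definition abhom (U V : zmodType) : Type := {additive U -> V}.

Section AbHom.
Variables U V : zmodType.
Implicit Types f g h : abhom U V.

HB.instance Definition _ := gen_eqMixin (abhom U V).
HB.instance Definition _ := gen_choiceMixin (abhom U V).

Definition abhom_fun f : U -> V := (f : {additive U -> V}).

Lemma abhomP f g : abhom_fun f =1 abhom_fun g -> f = g.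
Proof.
case: f g => [f [[fm]]] [g [[gm]]]; rewrite /abhom_fun /= => /funext E.
by move: fm gm; rewrite E => fm gm; rewrite (Prop_irrelevance fm gm).
Qed.

Definition abhom0 : abhom U V := (\0 : {additive U -> V}).
Definition abhomN f : abhom U V := (\- f : {additive U -> V}).
Definition abhomD f g : abhom U V := (f \+ g : {additive U -> V}).

Fact abhomDA : associative abhomD.
Proof. by move=> f g h; apply: abhomP => x; exact: addrA. Qed.
Fact abhomDC : commutative abhomD.
Proof. by move=> f g; apply: abhomP => x; exact: addrC. Qed.
Fact abhom0D : left_id abhom0 abhomD.
Proof. by move=> f; apply: abhomP => x; exact: add0r. Qed.
Fact abhomND : left_inverse abhom0 abhomN abhomD.
Proof. by move=> f; apply: abhomP => x; exact: addNr. Qed.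

HB.instance Definition _ :=
  GRing.isZmodule.Build (abhom U V) abhomDA abhomDC abhom0D abhomND.
End AbHom.

Definition ab_id (U : zmodType) : abhom U U := (idfun : {additive U -> U}).
Definition ab_comp (U V W : zmodType) (g : abhom V W) (f : abhom U V) :
  abhom U W := (g \o f : {additive U -> W}).

Fact ab_compA U V W X (h : abhom W X) (g : abhom V W) (f : abhom U V) :
  ab_comp h (ab_comp g f) = ab_comp (ab_comp h g) f.
Proof. exact: abhomP. Qed.
Fact ab_comp1m U V (f : abhom U V) : ab_comp (ab_id V) f = f.
Proof. exact: abhomP. Qed.
Fact ab_compm1 U V (f : abhom U V) : ab_comp f (ab_id U) = f.
Proof. exact: abhomP. Qed.
Fact ab_compDl U V W (g g' : abhom V W) (f : abhom U V) :
  ab_comp (g + g') f = ab_comp g f + ab_comp g' f.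
Proof. exact: abhomP. Qed.
Fact ab_compDr U V W (g : abhom V W) (f f' : abhom U V) :
  ab_comp g (f + f') = ab_comp g f + ab_comp g f'.
Proof. by apply: abhomP => x; exact: raddfD. Qed.

Definition Ab : precat := @PreCat zmodType (fun U V => abhom U V : zmodType)
  ab_id ab_comp ab_compA ab_comp1m ab_compm1 ab_compDl ab_compDr.

Section PrecatTheory.
Variable C : precat.
Implicit Types X Y Z : C.

Lemma comp0l X Y Z (f : Hom X Y) : (0 : Hom Y Z) ∘ f = 0.
Proof. by apply: (addIr (0 ∘ f)); rewrite -compDl !add0r. Qed.
Lemma comp0r X Y Z (g : Hom Y Z) : g ∘ (0 : Hom X Y) = 0.
Proof. by apply: (addIr (g ∘ 0)); rewrite -compDr !add0r. Qed.
Lemma compNl X Y Z (g : Hom Y Z) (f : Hom X Y) : (- g) ∘ f = - (g ∘ f).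
Proof. by apply/eqP; rewrite -addr_eq0 -compDl addNr comp0l. Qed.
Lemma compNr X Y Z (g : Hom Y Z) (f : Hom X Y) : g ∘ (- f) = - (g ∘ f).
Proof. by apply/eqP; rewrite -addr_eq0 -compDr addNr comp0r. Qed.
Lemma compBl X Y Z (g g' : Hom Y Z) (f : Hom X Y) :
  (g - g') ∘ f = g ∘ f - g' ∘ f.
Proof. by rewrite compDl compNl. Qed.
Lemma compBr X Y Z (g : Hom Y Z) (f f' : Hom X Y) :
  g ∘ (f - f') = g ∘ f - g ∘ f'.
Proof. by rewrite compDr compNr. Qed.
End PrecatTheory.

Section Representable.
Variables (C : precat) (M : C).

Section Map.
Variables (X Y : C) (f : Hom X Y).
Definition repr_fun (u : Hom Y M) : Hom X M := u ∘ f.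
Fact repr_fun_additive : nmod_morphism repr_fun.
Proof. by split=> [|u v]; rewrite /repr_fun ?comp0l ?compDl. Qed.
HB.instance Definition _ :=
  GRing.isNmodMorphism.Build (Hom Y M) (Hom X M) repr_fun repr_fun_additive.
Definition repr_map : abhom (Hom Y M) (Hom X M) :=
  (repr_fun : {additive _ -> _}).
End Map.

Fact repr_1 X : repr_map (idm X) = ab_id (Hom X M).
Proof. by apply: abhomP => u; exact: compm1. Qed.
Fact repr_M X Y Z (g : @Hom C Y Z) (f : Hom X Y) :
  repr_map (g ∘ f) = ab_comp (repr_map f) (repr_map g).
Proof. by apply: abhomP => u; exact: compA. Qed.
Fact repr_D X Y (f g : @Hom C X Y) :
  repr_map (f + g) = repr_map f + repr_map g.
Proof. by apply: abhomP => u; exact: compDr. Qed.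

Definition representable : cofunctor C Ab :=
  @CoFunctor C Ab (fun X => Hom X M) repr_map repr_1 repr_M repr_D.
End Representable.

(* The shift [1] is an autoequivalence, with a chosen quasi-inverse [-1];
   [dist f g h] says that X -f-> Y -g-> Z -h-> X[1] is distinguished. *)
Record tricat := TriCat {
  tri_cat :> precat;
  tri_additive : additive_cat tri_cat;
  shift : functor tri_cat tri_cat;
  unshift : functor tri_cat tri_cat;
  shift_unit : nat_iso (fid tri_cat) (fcomp unshift shift);
  shift_counit : nat_iso (fcomp shift unshift) (fid tri_cat);
  dist : forall X Y Z : tri_cat,
    Hom X Y -> Hom Y Z -> Hom Z (shift X) -> Prop;
  tri_iso : forall (X Y Z X' Y' Z' : tri_cat)
      (f : Hom X Y) (g : Hom Y Z) (h : Hom Z (shift X))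
      (f' : Hom X' Y') (g' : Hom Y' Z') (h' : Hom Z' (shift X'))
      (a : Hom X X') (b : Hom Y Y') (c : Hom Z Z'),
    is_iso a -> is_iso b -> is_iso c ->
    b ∘ f = f' ∘ a -> c ∘ g = g' ∘ b -> fmap shift a ∘ h = h' ∘ c ->
    dist f g h -> dist f' g' h';
  tri_id : forall X Z : tri_cat, zero_obj Z ->
    dist (idm X) (0 : Hom X Z) 0;
  tri_cone : forall (X Y : tri_cat) (f : Hom X Y),
    exists Z (g : Hom Y Z) (h : Hom Z (shift X)), dist f g h;
  tri_rot : forall (X Y Z : tri_cat)
      (f : Hom X Y) (g : Hom Y Z) (h : Hom Z (shift X)),
    dist f g h <-> dist g h (- fmap shift f);
  tri_mor : forall (X Y Z X' Y' Z' : tri_cat)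
      (f : Hom X Y) (g : Hom Y Z) (h : Hom Z (shift X))
      (f' : Hom X' Y') (g' : Hom Y' Z') (h' : Hom Z' (shift X'))
      (a : Hom X X') (b : Hom Y Y'),
    dist f g h -> dist f' g' h' -> b ∘ f = f' ∘ a ->
    exists c : Hom Z Z', c ∘ g = g' ∘ b /\ fmap shift a ∘ h = h' ∘ c;
  tri_oct : forall (X Y Z Z' X' Y' : tri_cat) (f : Hom X Y) (g : Hom Y Z)
      (i : Hom Y Z') (i' : Hom Z' (shift X))
      (j : Hom Z X') (j' : Hom X' (shift Y))
      (k : Hom Z Y') (k' : Hom Y' (shift X)),
    dist f i i' -> dist g j j' -> dist (g ∘ f) k k' ->
    exists (u : Hom Z' Y') (v : Hom Y' X'),
      [/\ dist u v (fmap shift i ∘ j'), u ∘ i = k ∘ g, k' ∘ u = i',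
          v ∘ k = j & j' ∘ v = fmap shift f ∘ k'] }.

Arguments shift {t}.
Arguments unshift {t}.
Arguments shift_unit {t}.
Arguments shift_counit {t}.
Arguments dist {t X Y Z} f g h.

Definition shiftz (C : tricat) (i : int) : functor C C :=
  match i with
  | Posz k => fiter k shift
  | Negz k => fiter k.+1 unshift
  end.

Definition cohomological (C : tricat) (A : abcat) (H : cofunctor C A) : Prop :=
  forall (X Y Z : C) (f : Hom X Y) (g : Hom Y Z) (h : Hom Z (shift X)),
    dist f g h -> exact_at (cmap H g) (cmap H f).

(* The class P[i] of objects isomorphic to Y[i] for some Y in P. *)
Definition in_shift (C : tricat) (P : C -> Prop) (i : int) (X : C) : Prop :=
  exists Y, P Y /\ isom X (shiftz C i Y).

Record weight_structure (C : tricat) := WeightStructure {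
  wle0 : C -> Prop;
  wge0 : C -> Prop;
  wle0_retract : forall X Y : C, retract X Y -> wle0 Y -> wle0 X;
  wge0_retract : forall X Y : C, retract X Y -> wge0 Y -> wge0 X;
  wle0_shift : forall X, wle0 X -> in_shift wle0 1 X;
  wge0_shift : forall X, in_shift wge0 1 X -> wge0 X;
  w_orth : forall X Y (f : Hom X Y), wle0 X -> in_shift wge0 1 Y -> f = 0;
  w_decomp : forall M : C, exists (L R : C)
      (a : Hom L M) (b : Hom M R) (c : Hom R (shift L)),
    [/\ dist a b c, wle0 L & in_shift wge0 1 R] }.

Section WeightClasses.
Variables (C : tricat) (w : weight_structure C).

Definition wle (i : int) : C -> Prop := in_shift (wle0 w) i.
Definition wge (i : int) : C -> Prop := in_shift (wge0 w) i.
Definition weq (i : int) (X : C) : Prop := wle i X /\ wge i X.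

Definition bounded : Prop :=
  forall X, (exists i, wle i X) /\ (exists i, wge i X).

Definition heart : precat := @PreCat {X : C | weq 0 X}
  (fun X Y => Hom (sval X) (sval Y)) (fun X => idm (sval X))
  (fun X Y Z g f => g ∘ f)
  (fun _ _ _ _ => @compA C _ _ _ _) (fun _ _ => @comp1m C _ _)
  (fun _ _ => @compm1 C _ _) (fun _ _ _ => @compDl C _ _ _)
  (fun _ _ _ => @compDr C _ _ _).

Section WeightRange.
Variables (D : precat) (H : cofunctor C D).
Definition weight_range_ge (m : int) : Prop := kills H (wle (m - 1)).
Definition weight_range_le (n : int) : Prop := kills H (wge (n + 1)).
Definition weight_range (m n : int) : Prop := weight_range_ge m /\ weight_range_le n.
End WeightRange.

(* An i-weight decomposition wl -> M -> wr -> wl[1] of M. *)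
Record wdec (i : int) (M : C) := WDec {
  wl : C;
  wr : C;
  wla : Hom wl M;
  wrb : Hom M wr;
  wdc : Hom wr (shift wl);
  wd_dist : dist wla wrb wdc;
  wd_le : wle i wl;
  wd_ge : wge (i + 1) wr }.

End WeightClasses.

Section IsoTheory.
Variable C : precat.
Implicit Types X Y Z : C.

Lemma isom_refl X : isom X X.
Proof. by exists (idm X), (idm X); rewrite comp1m. Qed.
Lemma isom_sym X Y : isom X Y -> isom Y X.
Proof. by move=> [f [g [gf fg]]]; exists g, f. Qed.
Lemma isom_trans Y X Z : isom X Y -> isom Y Z -> isom X Z.
Proof.
move=> [f [f' [f'f ff']]] [g [g' [g'g gg']]]; exists (g ∘ f), (f' ∘ g'); split.
  by rewrite compA -(compA f') g'g compm1.
by rewrite compA -(compA g) ff' compm1.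
Qed.
Lemma isom_retract X Y : isom X Y -> retract X Y.
Proof. by move=> [f [g [gf fg]]]; exists f, g. Qed.
Lemma retract_trans Y X Z : retract X Y -> retract Y Z -> retract X Z.
Proof.
move=> [f [f' f'f]] [g [g' g'g]]; exists (g ∘ f), (f' ∘ g').
by rewrite compA -(compA f') g'g compm1.
Qed.
End IsoTheory.

Section FunctorTheory.
Variables (C D : precat) (F : functor C D).
Lemma fmap0 X Y : fmap F (0 : Hom X Y) = 0.
Proof. by apply: (addIr (fmap F 0)); rewrite -fmapD !add0r. Qed.
Lemma fmapN X Y (f : Hom X Y) : fmap F (- f) = - fmap F f.
Proof. by apply/eqP; rewrite -addr_eq0 -fmapD addNr fmap0. Qed.
Lemma fmapB X Y (f g : Hom X Y) : fmap F (f - g) = fmap F f - fmap F g.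
Proof. by rewrite fmapD fmapN. Qed.
Lemma isom_fmap X Y : isom X Y -> isom (F X) (F Y).
Proof.
by move=> [f [g [gf fg]]]; exists (fmap F f), (fmap F g); rewrite -!fmapM gf fg !fmap1.
Qed.
Lemma retract_fmap X Y : retract X Y -> retract (F X) (F Y).
Proof. by move=> [f [g gf]]; exists (fmap F f), (fmap F g); rewrite -!fmapM gf !fmap1. Qed.
End FunctorTheory.

Section CofunctorTheory.
Variables (C D : precat) (F : cofunctor C D).
Lemma cmap0 X Y : cmap F (0 : Hom X Y) = 0.
Proof. by apply: (addIr (cmap F 0)); rewrite -cmapD !add0r. Qed.
Lemma cmapN X Y (f : Hom X Y) : cmap F (- f) = - cmap F f.
Proof. by apply/eqP; rewrite -addr_eq0 -cmapD addNr cmap0. Qed.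
Lemma cmapB X Y (f g : Hom X Y) : cmap F (f - g) = cmap F f - cmap F g.
Proof. by rewrite cmapD cmapN. Qed.
End CofunctorTheory.

Lemma is_iso_epi (C : precat) (X Y : C) (f : Hom X Y) : is_iso f -> epi f.
Proof.
move=> [g [_ fg]] W u v E.
by rewrite -[u]compm1 -[v]compm1 -fg !compA E.
Qed.
Lemma is_iso_mono (C : precat) (X Y : C) (f : Hom X Y) : is_iso f -> mono f.
Proof.
move=> [g [gf _]] W u v E.
by rewrite -[u]comp1m -[v]comp1m -gf -!compA E.
Qed.

Section TriangulatedTheory.
Variable C : tricat.
Implicit Types X Y Z W : C.

Lemma shift_faithful X Y (f g : Hom X Y) : fmap shift f = fmap shift g -> f = g.
Proof.
move=> E; apply: (is_iso_mono (ni_iso shift_unit Y)).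
by rewrite (ni_nat shift_unit f) (ni_nat shift_unit g) /= E.
Qed.
Lemma unshift_faithful X Y (f g : Hom X Y) :
  fmap unshift f = fmap unshift g -> f = g.
Proof.
move=> E; apply: (is_iso_epi (ni_iso shift_counit X)).
by rewrite -(ni_nat shift_counit f) -(ni_nat shift_counit g) /= E.
Qed.
Lemma shift_full X Y (v : Hom (shift X) (shift Y)) :
  exists u : Hom X Y, fmap shift u = v.
Proof.
have [e [ee' e'e]] := ni_iso shift_unit Y.
pose u : Hom X Y := e ∘ fmap unshift v ∘ ni_map shift_unit X.
exists u; apply: unshift_faithful.
apply: (is_iso_epi (ni_iso shift_unit X)).
by rewrite -[LHS](ni_nat shift_unit u) {1}/u !compA e'e comp1m.
Qed.

Lemma dist_comp0 X Y Z (f : Hom X Y) (g : Hom Y Z) h : dist f g h -> g ∘ f = 0.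
Proof.
move=> d; have [O OP] := (tri_additive C).1.
have [c [Ec _]] := tri_mor (a := idm X) (b := f) (tri_id X OP) d erefl.
by rewrite -Ec comp0r.
Qed.

Lemma dist_lift X Y Z (f : Hom X Y) (g : Hom Y Z) h W (u : Hom W Y) :
  dist f g h -> g ∘ u = 0 -> exists v : Hom W X, f ∘ v = u.
Proof.
move=> d gu; have [O OP] := (tri_additive C).1.
have t := (tri_rot _ _ _).1 (tri_id W OP).
have E : (0 : Hom O Z) ∘ (0 : Hom W O) = g ∘ u by rewrite gu comp0r.
have [c [_ Ec]] := tri_mor t ((tri_rot _ _ _).1 d) E.
have [v Ev] := shift_full c; exists v; apply: shift_faithful.
move: Ec; rewrite fmapM Ev fmap1 compNr compNl compm1 => /oppr_inj ->.
by [].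
Qed.

Lemma dist_desc X Y Z (f : Hom X Y) (g : Hom Y Z) h W (u : Hom Y W) :
  dist f g h -> u ∘ f = 0 -> exists v : Hom Z W, v ∘ g = u.
Proof.
move=> d uf; have [O OP] := (tri_additive C).1.
have SO : zero_obj (shift O).
  have i0 : idm (shift O) = 0 by rewrite -fmap1 (OP.1 _ (idm O)) fmap0.
  by split=> Y' a; [rewrite -[a]compm1 i0 comp0r | rewrite -[a]comp1m i0 comp0l].
have t : dist (0 : Hom O W) (idm W) (0 : Hom W (shift O)).
  apply/tri_rot; rewrite fmap0 oppr0; exact: tri_id.
have E : u ∘ f = 0 ∘ (0 : Hom X O) by rewrite uf comp0l.
have [c [Ec _]] := tri_mor d t E.
by exists c; rewrite Ec comp1m.
Qed.

Lemma dist_rot X Y Z (f : Hom X Y) (g : Hom Y Z) h :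
  dist f g h -> dist g h (- fmap shift f).
Proof. by move/tri_rot. Qed.

Lemma shiftz1 X : shiftz C 1 X = shift X.
Proof. by []. Qed.

Lemma shift_shiftz i X : isom (shift (shiftz C i X)) (shiftz C (i + 1) X).
Proof.
case: i => [k|[|k]].
- by rewrite -PoszD addn1; exact: isom_refl.
- by exists (ni_map shift_counit X); exact: (ni_iso shift_counit X).
have -> : Negz k.+1 + 1 = Negz k by rewrite !NegzE -addn1 PoszD opprD subrK.
exists (ni_map shift_counit (shiftz C (Negz k) X)).
exact: (ni_iso shift_counit _).
Qed.

Lemma unshift_shift X : isom (unshift (shift X)) X.
Proof. by apply: isom_sym; exists (ni_map shift_unit X); exact: (ni_iso shift_unit X). Qed.
Lemma shift_unshift X : isom (shift (unshift X)) X.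
Proof. by exists (ni_map shift_counit X); exact: (ni_iso shift_counit X). Qed.

Lemma unshift_shiftz i X : isom (unshift (shiftz C i X)) (shiftz C (i - 1) X).
Proof.
apply: isom_trans (unshift_shift _); apply: isom_fmap; apply: isom_sym.
by have := shift_shiftz (i - 1) X; rewrite subrK.
Qed.

Lemma shiftz_shift i X : isom (shiftz C i (shift X)) (shiftz C (i + 1) X).
Proof.
elim/int_ind: i => [|n IH|n IH]; first exact: isom_refl.
- have -> : n.+1%:Z = n%:Z + 1 by rewrite intS addrC.
  apply: isom_trans (isom_sym (shift_shiftz _ _)) _.
  exact: isom_trans (isom_fmap _ IH) (shift_shiftz _ _).
have -> : - n.+1%:Z = - n%:Z - 1 by rewrite intS opprD addrC.
apply: isom_trans (isom_sym (unshift_shiftz _ _)) _.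
apply: isom_trans (isom_fmap _ IH) _.
by apply: isom_trans (unshift_shiftz _ _) _; rewrite addrK subrK; exact: isom_refl.
Qed.

Variable P : C -> Prop.

Lemma in_shift_isom i X Y : isom X Y -> in_shift P i Y -> in_shift P i X.
Proof. by move=> e [Z [PZ e']]; exists Z; split=> //; exact: isom_trans e e'. Qed.

Lemma in_shiftS i X : in_shift P i X -> in_shift P (i + 1) (shift X).
Proof.
move=> [Y [PY e]]; exists Y; split=> //.
exact: isom_trans (isom_fmap _ e) (shift_shiftz _ _).
Qed.
Lemma in_shiftU i X : in_shift P i X -> in_shift P (i - 1) (unshift X).
Proof.
move=> [Y [PY e]]; exists Y; split=> //.
exact: isom_trans (isom_fmap _ e) (unshift_shiftz _ _).
Qed.
Lemma in_shiftSE i X : in_shift P (i + 1) (shift X) -> in_shift P i X.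
Proof.
move/in_shiftU; rewrite addrK; apply: in_shift_isom.
exact: isom_sym (unshift_shift _).
Qed.

Hypothesis Pret : forall X Y, retract X Y -> P Y -> P X.

Lemma in_shift_retract i X Y :
  retract X Y -> in_shift P i Y -> in_shift P i X.
Proof.
elim/int_ind: i X Y => [|n IH|n IH] X Y r.
- move=> [Z [PZ e]]; exists X; split; last exact: isom_refl.
  exact: Pret (retract_trans r (isom_retract e)) PZ.
- rewrite intS addrC => /in_shiftU; rewrite addrK => /IH h.
  apply: (@in_shift_isom _ _ (shift (unshift X))); first exact/isom_sym/shift_unshift.
  by apply: in_shiftS; apply: h; exact: retract_fmap.
have -> : - n.+1%:Z = - n%:Z - 1 by rewrite intS opprD addrC.
move=> h; apply: in_shiftSE; rewrite subrK.
move: h => /in_shiftS; rewrite subrK; apply: IH; exact: retract_fmap.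
Qed.
End TriangulatedTheory.

Section WeightTheory.
Variables (C : tricat) (w : weight_structure C).
Implicit Types X Y Z M : C.

Lemma wle_succ i X : wle w i X -> wle w (i + 1) X.
Proof.
move=> [Y [/wle0_shift[Z [PZ e]] e']]; exists Z; split=> //.
apply: isom_trans (e') _; apply: isom_trans (isom_fmap _ e) _.
rewrite shiftz1; exact: shiftz_shift.
Qed.

Lemma wge0_shiftz (k : nat) X : wge0 w X -> wge0 w (shiftz C k X).
Proof.
elim: k => // k IH /IH h; apply: wge0_shift; exists (shiftz C k X); split=> //.
exact: isom_refl.
Qed.

Lemma w_orthz i j X Y (f : Hom X Y) : wle w i X -> wge w j Y -> i < j -> f = 0.
Proof.
elim/int_ind: i j X Y f => [|n IH|n IH] j X Y f lX gY ij.
- have [Z [PZ [g gi]]] := lX; case: j ij gY => [[|k]|k] // _ [T [PT e]].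
  case: gi => g' [g'g gg'].
  have E : f ∘ g' = 0.
    apply: (w_orth (w := w)); first exact: PZ.
    exists (shiftz C k T); split; first exact: wge0_shiftz.
    exact: e.
  by rewrite -[f]compm1 -g'g compA E comp0l.
- apply: unshift_faithful; rewrite fmap0; apply: (IH (j - 1)).
  + by have := in_shiftU lX; rewrite intS addrAC subrr add0r.
  + exact: in_shiftU.
  by rewrite ltrBrDr; move: ij; rewrite intS addrC.
apply: shift_faithful; rewrite fmap0; apply: (IH (j + 1)).
+ by have := in_shiftS lX; rewrite intS opprD addrC addNKr.
+ exact: in_shiftS.
by rewrite -ltrBlDr; move: ij; rewrite intS opprD addrC.
Qed.
End WeightTheory.

Section Extension.
Variables (C : tricat) (w : weight_structure C).
Implicit Types M N : C.

Definition wd_mor i j M N (d : wdec w i M) (d' : wdec w j N) (g : Hom M N)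
    (ac : Hom (wl d) (wl d') * Hom (wr d) (wr d')) : Prop :=
  [/\ wla d' ∘ ac.1 = g ∘ wla d, ac.2 ∘ wrb d = wrb d' ∘ g
    & fmap shift ac.1 ∘ wdc d = wdc d' ∘ ac.2].

Lemma wl_uniq k j N (d' : wdec w j N) X (e : Hom X (wl d')) :
  wle w k X -> k < j -> wla d' ∘ e = 0 -> e = 0.
Proof.
move=> lX kj E; apply: shift_faithful; rewrite fmap0.
have t := dist_rot (dist_rot (wd_dist d')).
have Es : (- fmap shift (wla d')) ∘ fmap shift e = 0.
  by rewrite compNl -fmapM E fmap0 oppr0.
have [v <-] := dist_lift t Es.
rewrite (w_orthz v (in_shiftS lX) (wd_ge d')) ?comp0r //.
by rewrite ltrD2r.
Qed.

Lemma wr_uniq i k M (d : wdec w i M) X (e : Hom (wr d) X) :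
  wge w k X -> i + 1 < k -> e ∘ wrb d = 0 -> e = 0.
Proof.
move=> gX ik E.
have [v <-] := dist_desc (dist_rot (wd_dist d)) E.
by rewrite (w_orthz v (in_shiftS (wd_le d)) gX ik) comp0l.
Qed.

Lemma wl_lift k j N (d' : wdec w j N) X (f : Hom X N) :
  wle w k X -> k <= j -> exists a : Hom X (wl d'), wla d' ∘ a = f.
Proof.
move=> lX kj; apply: (dist_lift (wd_dist d')).
apply: (w_orthz _ lX (wd_ge d')).
by rewrite ltzD1.
Qed.

Lemma wd_mor_ex i j M N (d : wdec w i M) (d' : wdec w j N) (g : Hom M N) :
  i <= j -> exists ac, wd_mor (d := d) (d' := d') g ac.
Proof.
move=> ij; have [a Ea] := wl_lift d' (g ∘ wla d) (wd_le d) ij.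
have [c [Ec Ec']] := tri_mor (wd_dist d) (wd_dist d') (esym Ea).
by exists (a, c).
Qed.

(* A morphism of triangles over g; it is unique when i < j. *)
Definition wd_ext i j M N (ij : i <= j) (d : wdec w i M) (d' : wdec w j N)
    (g : Hom M N) : Hom (wl d) (wl d') * Hom (wr d) (wr d') :=
  sval (cid (wd_mor_ex d d' g ij)).

Lemma wd_extP i j M N (ij : i <= j) (d : wdec w i M) (d' : wdec w j N) g :
  wd_mor g (wd_ext ij d d' g).
Proof. exact: svalP (cid (wd_mor_ex d d' g ij)). Qed.

Lemma wd_ext_uniq i j M N (ij : i <= j) (d : wdec w i M) (d' : wdec w j N) g ac :
  i < j -> wd_mor g ac -> ac = wd_ext ij d d' g.
Proof.
case: ac => a c lt [Ea Ec _]; case: (wd_extP ij d d' g).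
case: (wd_ext _ _ _ _) => a' c' /= Ea' Ec' _.
congr pair; apply/eqP; rewrite -subr_eq0; apply/eqP.
  by apply: (wl_uniq (wd_le d) lt); rewrite compBr Ea' -Ea subrr.
apply: (wr_uniq (wd_ge d')); first by rewrite ltrD2r.
by rewrite compBl Ec' -Ec subrr.
Qed.

Lemma wd_ext_comp i j k M N L (ij : i <= j) (jk : j <= k) (ik : i <= k)
    (d : wdec w i M) (d' : wdec w j N) (d'' : wdec w k L)
    (g : Hom M N) (h : Hom N L) : i < k ->
  ((wd_ext jk d' d'' h).1 ∘ (wd_ext ij d d' g).1,
   (wd_ext jk d' d'' h).2 ∘ (wd_ext ij d d' g).2) = wd_ext ik d d'' (h ∘ g).
Proof.
move=> lt; apply: wd_ext_uniq => //.
have [E1 E2 E3] := wd_extP ij d d' g; have [F1 F2 F3] := wd_extP jk d' d'' h.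
split=> /=.
- by rewrite compA F1 -compA E1 compA.
- by rewrite -compA E2 compA F2 compA.
by rewrite fmapM -compA E3 compA F3 compA.
Qed.

Lemma wd_extD i j M N (ij : i <= j) (d : wdec w i M) (d' : wdec w j N) g h :
  i < j -> wd_ext ij d d' (g + h) =
    ((wd_ext ij d d' g).1 + (wd_ext ij d d' h).1,
     (wd_ext ij d d' g).2 + (wd_ext ij d d' h).2).
Proof.
move=> lt; apply/esym/wd_ext_uniq => //.
have [E1 E2 E3] := wd_extP ij d d' g; have [F1 F2 F3] := wd_extP ij d d' h.
split=> /=.
- by rewrite compDr E1 F1 compDl.
- by rewrite compDl E2 F2 compDr.
by rewrite fmapD compDl E3 F3 compDr.
Qed.
End Extension.

Section AbelianTheory.
Variable A : abcat.
Implicit Types X Y Z W : A.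

Lemma kernel_mono K Y Z (g : Hom Y Z) (k : @Hom A K Y) : is_kernel g k -> mono k.
Proof.
move=> [gk kP] W u v E.
have [|x [_ xP]] := kP _ (k ∘ u); first by rewrite compA gk comp0l.
by rewrite -(xP u erefl) -(xP v (esym E)).
Qed.

Lemma cokernel_epi X Y Q (f : Hom X Y) (q : @Hom A Y Q) : is_cokernel f q -> epi q.
Proof.
move=> [qf qP] W u v E.
have [|x [_ xP]] := qP _ (u ∘ q); first by rewrite -compA qf comp0r.
by rewrite -(xP u erefl) -(xP v (esym E)).
Qed.

Section Chosen.
Variables (X Y : A) (f : Hom X Y).

Lemma ker_ex : exists K : {K : A & Hom K X}, is_kernel f (projT2 K).
Proof. by have [K [k kP]] := ab_ker f; exists (existT _ K k). Qed.
Definition ker : A := projT1 (sval (cid ker_ex)).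
Definition ker_in : Hom ker X := projT2 (sval (cid ker_ex)).
Lemma ker_inP : is_kernel f ker_in. Proof. exact: svalP (cid ker_ex). Qed.

Lemma coker_ex : exists Q : {Q : A & Hom Y Q}, is_cokernel f (projT2 Q).
Proof. by have [Q [q qP]] := ab_coker f; exists (existT _ Q q). Qed.
Definition coker : A := projT1 (sval (cid coker_ex)).
Definition coker_out : Hom Y coker := projT2 (sval (cid coker_ex)).
Lemma coker_outP : is_cokernel f coker_out. Proof. exact: svalP (cid coker_ex). Qed.

Lemma im_ex : exists I : {I : A & Hom I Y}, is_image f (projT2 I).
Proof.
have [Q [q qP]] := ab_coker f; have [I [i iP]] := ab_ker q.
by exists (existT _ I i), Q, q.
Qed.
Definition im : A := projT1 (sval (cid im_ex)).
Definition im_in : Hom im Y := projT2 (sval (cid im_ex)).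
Lemma im_inP : is_image f im_in. Proof. exact: svalP (cid im_ex). Qed.

Lemma im_in_mono : mono im_in.
Proof. by have [Q [q [_ /kernel_mono]]] := im_inP. Qed.

Lemma im_out_ex : exists e : Hom X im, im_in ∘ e = f.
Proof. by have [Q [q [[qf _] [_ /(_ _ _ qf) [e [eP _]]]]]] := im_inP; exists e. Qed.
Definition im_out : Hom X im := sval (cid im_out_ex).
Lemma im_inK : im_in ∘ im_out = f. Proof. exact: svalP (cid im_out_ex). Qed.

Lemma im_out_epi : epi im_out.
Proof.
suff H W (u : Hom im W) : u ∘ im_out = 0 -> u = 0.
  move=> W u v E; apply/eqP; rewrite -subr_eq0; apply/eqP/H.
  by rewrite compBl E subrr.
move=> u0; have [K [k kP]] := ab_ker u.
have [e' [Ee' _]] := kP.2 _ _ u0.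
have mik : mono (im_in ∘ k).
  move=> V a b; rewrite -!compA => /im_in_mono; exact: (kernel_mono kP).
have [Z [p pP]] := ab_mono mik.
have [Q [q [[qf qP] iP]]] := im_inP.
have pf : p ∘ f = 0 by rewrite -im_inK -Ee' compA compA -(compA p) pP.1 comp0l.
have [p' [Ep' _]] := qP _ _ pf.
have pi : p ∘ im_in = 0 by rewrite -Ep' -compA iP.1 comp0r.
have [s [Es _]] := pP.2 _ _ pi.
have ks : k ∘ s = idm im.
  by apply: im_in_mono; rewrite compA Es compm1.
by rewrite -[u]compm1 -ks compA kP.1 comp0l.
Qed.
End Chosen.

Section Homology.
Variables (X Y Z : A) (f : Hom X Y) (g : Hom Y Z) (gf : g ∘ f = 0).

Lemma ker_lift_ex : exists l : Hom X (ker g), ker_in g ∘ l = f.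
Proof. by have [l [lP _]] := (ker_inP g).2 _ _ gf; exists l. Qed.
Definition ker_lift : Hom X (ker g) := sval (cid ker_lift_ex).
Lemma ker_liftK : ker_in g ∘ ker_lift = f.
Proof. exact: svalP (cid ker_lift_ex). Qed.

(* The homology at Y of the complex X -f-> Y -g-> Z. *)
Definition homology : A := coker ker_lift.
Definition homology_out : Hom (ker g) homology := coker_out ker_lift.
End Homology.

(* t is the morphism on homology induced by y : Y -> Y'. *)
Definition homology_ind X Y Z (f : Hom X Y) (g : Hom Y Z) (gf : g ∘ f = 0)
    X' Y' Z' (f' : Hom X' Y') (g' : Hom Y' Z') (gf' : g' ∘ f' = 0)
    (y : Hom Y Y') (t : Hom (homology gf) (homology gf')) : Prop :=
  exists k : Hom (ker g) (ker g'),
    ker_in g' ∘ k = y ∘ ker_in g /\ t ∘ homology_out gf = homology_out gf' ∘ k.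

Section HomologyInd.
Variables (X Y Z : A) (f : Hom X Y) (g : Hom Y Z) (gf : g ∘ f = 0).
Variables (X' Y' Z' : A) (f' : Hom X' Y') (g' : Hom Y' Z') (gf' : g' ∘ f' = 0).

Lemma homology_ind_ex (y : Hom Y Y') (x : Hom X X') (z : Hom Z Z') :
  f' ∘ x = y ∘ f -> z ∘ g = g' ∘ y ->
  exists t, homology_ind (gf := gf) (gf' := gf') y t.
Proof.
move=> Ex Ez.
have gy : g' ∘ (y ∘ ker_in g) = 0.
  by rewrite compA -Ez -compA (ker_inP g).1 comp0r.
have [k [Ek _]] := (ker_inP g').2 _ _ gy.
have E : homology_out gf' ∘ k ∘ ker_lift gf = 0.
  have -> : homology_out gf' ∘ k ∘ ker_lift gf =
            homology_out gf' ∘ (ker_lift gf' ∘ x).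
    rewrite -compA; congr (_ ∘ _); apply: (kernel_mono (ker_inP g')).
    by rewrite !compA Ek -compA !ker_liftK.
  by rewrite compA (coker_outP _).1 comp0l.
have [t [Et _]] := (coker_outP (ker_lift gf)).2 _ _ E.
by exists t, k.
Qed.

Lemma homology_ind0 (y : Hom Y Y') t (s : Hom Y X') (r : Hom Z Y') :
  homology_ind (gf := gf) (gf' := gf') y t -> y = f' ∘ s + r ∘ g -> t = 0.
Proof.
move=> [k [Ek Et]] Ey; apply: (cokernel_epi (coker_outP (ker_lift gf))).
rewrite comp0l [LHS]Et.
have -> : k = ker_lift gf' ∘ (s ∘ ker_in g).
  apply: (kernel_mono (ker_inP g')).
  rewrite Ek Ey compDl -(compA r) (ker_inP g).1 comp0r addr0.
  by rewrite (compA (ker_in g')) ker_liftK compA.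
by rewrite compA (coker_outP _).1 comp0l.
Qed.

Lemma homology_indD (y y' : Hom Y Y') t t' :
  homology_ind (gf := gf) (gf' := gf') y t ->
  homology_ind (gf := gf) (gf' := gf') y' t' ->
  homology_ind (gf := gf) (gf' := gf') (y + y') (t + t').
Proof.
move=> [k [Ek Et]] [k' [Ek' Et']]; exists (k + k').
by rewrite compDr Ek Ek' !compDl Et Et' compDr.
Qed.

Lemma homology_indN (y : Hom Y Y') t :
  homology_ind (gf := gf) (gf' := gf') y t ->
  homology_ind (gf := gf) (gf' := gf') (- y) (- t).
Proof.
by move=> [k [Ek Et]]; exists (- k); rewrite !compNl !compNr Ek Et.
Qed.
End HomologyInd.

Lemma homology_ind1 X Y Z (f : Hom X Y) (g : Hom Y Z) (gf : g ∘ f = 0) :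
  homology_ind (gf := gf) (gf' := gf) (idm Y) (idm _).
Proof. by exists (idm _); rewrite !compm1 !comp1m. Qed.

Lemma homology_indM X Y Z (f : Hom X Y) (g : Hom Y Z) (gf : g ∘ f = 0)
    X' Y' Z' (f' : Hom X' Y') (g' : Hom Y' Z') (gf' : g' ∘ f' = 0)
    X'' Y'' Z'' (f'' : Hom X'' Y'') (g'' : Hom Y'' Z'') (gf'' : g'' ∘ f'' = 0)
    (y : Hom Y Y') (y' : Hom Y' Y'') t t' :
  homology_ind (gf := gf) (gf' := gf') y t ->
  homology_ind (gf := gf') (gf' := gf'') y' t' ->
  homology_ind (gf := gf) (gf' := gf'') (y' ∘ y) (t' ∘ t).
Proof.
move=> [k [Ek Et]] [k' [Ek' Et']]; exists (k' ∘ k); split.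
  by rewrite compA Ek' -compA Ek compA.
by rewrite -compA Et compA Et' compA.
Qed.
End AbelianTheory.

(* The functor M |-> Im (P M -> Q M), where P M -> Q M is [c (idm M)] and c g is
   the common value of the composites P N -> Q N -> Q M and P N -> P M -> Q M
   for g : M -> N. *)
Section ImageFunctor.
Variables (C : precat) (A : abcat) (P Q : C -> A).
Variable c : forall M N : C, Hom M N -> Hom (P N) (Q M).
Hypothesis cD : forall (M N : C) (g h : Hom M N), c (g + h) = c g + c h.
Hypothesis cP : forall (M N : C) (g : Hom M N), exists u : Hom (P N) (P M),
  forall (L : C) (h : Hom L M), c h ∘ u = c (g ∘ h).
Hypothesis cQ : forall (M N : C) (g : Hom M N), exists v : Hom (Q N) (Q M),
  forall (L : C) (h : Hom N L), v ∘ c h = c (h ∘ g).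

Lemma image_map_ex M N (g : Hom M N) :
  exists t : Hom (im (c (idm N))) (im (c (idm M))),
    im_in (c (idm M)) ∘ t ∘ im_out (c (idm N)) = c g.
Proof.
have [u Eu] := cP g; have [v Ev] := cQ g.
have [B [q [[qf _] [_ iP]]]] := im_inP (c (idm M)).
have E : q ∘ (v ∘ im_in (c (idm N))) = 0.
  apply: (im_out_epi (f := c (idm N))).
  rewrite comp0l -!compA im_inK Ev comp1m -[g in c g]compm1 -Eu.
  by rewrite compA qf comp0l.
have [t [Et _]] := iP _ _ E.
by exists t; rewrite Et -compA im_inK Ev comp1m.
Qed.

Definition image_map M N (g : Hom M N) :
    Hom (im (c (idm N))) (im (c (idm M))) := sval (cid (image_map_ex g)).
Lemma image_mapP M N (g : Hom M N) :
  im_in (c (idm M)) ∘ image_map g ∘ im_out (c (idm N)) = c g.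
Proof. exact: svalP (cid (image_map_ex g)). Qed.

Lemma image_map_uniq M N (g : Hom M N) t :
  im_in (c (idm M)) ∘ t ∘ im_out (c (idm N)) = c g -> t = image_map g.
Proof.
rewrite -[RHS]image_mapP => E.
by apply: im_in_mono; exact: (im_out_epi E).
Qed.

Fact image_map1 M : image_map (idm M) = idm (im (c (idm M))).
Proof. by apply/esym/image_map_uniq; rewrite compm1 im_inK. Qed.

Fact image_mapM L M N (g : Hom M N) (f : Hom L M) :
  image_map (g ∘ f) = image_map f ∘ image_map g.
Proof.
apply/esym/image_map_uniq; have [v Ev] := cQ f.
have Ef : im_in (c (idm L)) ∘ image_map f = v ∘ im_in (c (idm M)).
  apply: (im_out_epi (f := c (idm M))).
  by rewrite image_mapP -compA im_inK Ev comp1m.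
by rewrite compA Ef -!compA (compA (im_in _)) image_mapP Ev.
Qed.

Fact image_mapD M N (f g : Hom M N) :
  image_map (f + g) = image_map f + image_map g.
Proof. by apply/esym/image_map_uniq; rewrite compDr compDl !image_mapP cD. Qed.

Definition image_functor : cofunctor C A :=
  @CoFunctor C A (fun M => im (c (idm M))) image_map
    image_map1 image_mapM image_mapD.
End ImageFunctor.

Definition wd_choice (C : tricat) (w : weight_structure C) : Type :=
  forall (i : int) (M : C), wdec w i M.

Lemma lez_succ (n : int) : n <= n + 1. Proof. by rewrite lerDl. Qed.
Lemma ltz_succ (n : int) : n < n + 1. Proof. by rewrite ltrDl. Qed.
Lemma ltz_pred2 (n : int) : n - 2 < n - 1. Proof. by rewrite ltrD2l. Qed.
Lemma ltz_pred (i : int) : i - 1 < i. Proof. by rewrite ltrBlDr ltz_succ. Qed.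
Definition lez_pred2 (n : int) : n - 2 <= n - 1 := ltW (ltz_pred2 n).
Definition lez_pred (i : int) : i - 1 <= i := ltW (ltz_pred i).

Section VirtualTruncations.
Variables (C : tricat) (w : weight_structure C) (D : wd_choice w).
Variables (A : abcat) (H : cofunctor C A) (n : int).

Definition tau_ge_fun M N (g : Hom M N) :
    Hom (H (wl (D (n + 1) N))) (H (wl (D n M))) :=
  cmap H (wd_ext (lez_succ n) (D n M) (D (n + 1) N) g).1.

Fact tau_ge_funD M N (g h : Hom M N) :
  tau_ge_fun (g + h) = tau_ge_fun g + tau_ge_fun h.
Proof. by rewrite /tau_ge_fun wd_extD ?ltz_succ //= cmapD. Qed.

Fact tau_ge_funP M N (g : Hom M N) :
  exists u : Hom (H (wl (D (n + 1) N))) (H (wl (D (n + 1) M))),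
  forall L (h : Hom L M), tau_ge_fun h ∘ u = tau_ge_fun (g ∘ h).
Proof.
exists (cmap H (wd_ext (lexx _) (D (n + 1) M) (D (n + 1) N) g).1) => L h.
rewrite /tau_ge_fun -cmapM; congr (cmap H _).
by rewrite -(wd_ext_comp (lez_succ n) (lexx _) (lez_succ n) _ (D (n + 1) M)) ?ltz_succ.
Qed.

Fact tau_ge_funQ M N (g : Hom M N) :
  exists v : Hom (H (wl (D n N))) (H (wl (D n M))),
  forall L (h : Hom N L), v ∘ tau_ge_fun h = tau_ge_fun (h ∘ g).
Proof.
exists (cmap H (wd_ext (lexx _) (D n M) (D n N) g).1) => L h.
rewrite /tau_ge_fun -cmapM; congr (cmap H _).
by rewrite -(wd_ext_comp (lexx _) (lez_succ n) (lez_succ n) _ (D n N)) ?ltz_succ.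
Qed.

(* tau^{>= -n}(H) : M |-> Im (H(w_{<= n+1} M) -> H(w_{<= n} M)) *)
Definition tau_ge : cofunctor C A :=
  image_functor (P := fun M => H (wl (D (n + 1) M)))
    (Q := fun M => H (wl (D n M))) tau_ge_funD tau_ge_funP tau_ge_funQ.

Definition tau_le_fun M N (g : Hom M N) :
    Hom (H (wr (D (n - 1) N))) (H (wr (D (n - 2) M))) :=
  cmap H (wd_ext (lez_pred2 n) (D (n - 2) M) (D (n - 1) N) g).2.

Fact tau_le_funD M N (g h : Hom M N) :
  tau_le_fun (g + h) = tau_le_fun g + tau_le_fun h.
Proof. by rewrite /tau_le_fun wd_extD ?ltz_pred2 //= cmapD. Qed.

Fact tau_le_funP M N (g : Hom M N) :
  exists u : Hom (H (wr (D (n - 1) N))) (H (wr (D (n - 1) M))),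
  forall L (h : Hom L M), tau_le_fun h ∘ u = tau_le_fun (g ∘ h).
Proof.
exists (cmap H (wd_ext (lexx _) (D (n - 1) M) (D (n - 1) N) g).2) => L h.
rewrite /tau_le_fun -cmapM; congr (cmap H _).
by rewrite -(wd_ext_comp (lez_pred2 n) (lexx _) (lez_pred2 n) _ (D (n - 1) M))
  ?ltz_pred2.
Qed.

Fact tau_le_funQ M N (g : Hom M N) :
  exists v : Hom (H (wr (D (n - 2) N))) (H (wr (D (n - 2) M))),
  forall L (h : Hom N L), v ∘ tau_le_fun h = tau_le_fun (h ∘ g).
Proof.
exists (cmap H (wd_ext (lexx _) (D (n - 2) M) (D (n - 2) N) g).2) => L h.
rewrite /tau_le_fun -cmapM; congr (cmap H _).
by rewrite -(wd_ext_comp (lexx _) (lez_pred2 n) (lez_pred2 n) _ (D (n - 2) N))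
  ?ltz_pred2.
Qed.

(* tau^{<= -n}(H) : M |-> Im (H(w_{>= n} M) -> H(w_{>= n-1} M)); here
   w_{>= i} M is the third term of the chosen (i-1)-weight decomposition. *)
Definition tau_le : cofunctor C A :=
  image_functor (P := fun M => H (wr (D (n - 1) M)))
    (Q := fun M => H (wr (D (n - 2) M))) tau_le_funD tau_le_funP tau_le_funQ.
End VirtualTruncations.

(* A distinguished triangle w_{<= i-1} M -> w_{<= i} M -> M_i -> w_{<= i-1} M [1] *)
Record wcone (C : tricat) (w : weight_structure C) (D : wd_choice w)
    (i : int) (M : C) := WCone {
  gr : C;
  gr_in : Hom (wl (D i M)) gr;
  gr_out : Hom gr (shift (wl (D (i - 1) M)));
  gr_dist : dist (wd_ext (lez_pred i) (D (i - 1) M) (D i M) (idm M)).1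
                 gr_in gr_out }.

Definition wcone_choice (C : tricat) (w : weight_structure C)
    (D : wd_choice w) : Type := forall (i : int) (M : C), wcone D i M.

Section WeightComplex.
Variables (C : tricat) (w : weight_structure C) (D : wd_choice w).
Variable E : wcone_choice D.
Implicit Types L M N X Y : C.

Let w_in i M := (wd_ext (lez_pred i) (D (i - 1) M) (D i M) (idm M)).1.

Lemma w_inK i M : wla (D i M) ∘ w_in i M = wla (D (i - 1) M).
Proof.
have [-> _ _] := wd_extP (lez_pred i) (D (i - 1) M) (D i M) (idm M).
by rewrite comp1m.
Qed.

Lemma wle_orth i X :
  (forall Y (f : Hom X Y), wge w (i + 1) Y -> f = 0) -> wle w i X.
Proof.
move=> h; have b0 : wrb (D i X) ∘ idm X = 0 by apply: h; exact: wd_ge.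
have [v Ev] := dist_lift (wd_dist (D i X)) b0.
apply: (in_shift_retract (@wle0_retract _ w)) (wd_le (D i X)).
by exists v, (wla (D i X)).
Qed.

Lemma wge_orth i X :
  (forall Y (f : Hom Y X), wle w (i - 1) Y -> f = 0) -> wge w i X.
Proof.
move=> h; have a0 : idm X ∘ wla (D (i - 1) X) = 0 by apply: h; exact: wd_le.
have [v Ev] := dist_desc (wd_dist (D (i - 1) X)) a0.
have := wd_ge (D (i - 1) X); rewrite subrK.
apply: (in_shift_retract (@wge0_retract _ w)).
by exists (wrb (D (i - 1) X)), v.
Qed.

Lemma gr_weq i M : weq w i (gr (E i M)).
Proof.
have d := gr_dist (E i M); split.
  apply: wle_orth => Y f gY.
  have f0 : f ∘ gr_in (E i M) = 0.
    exact: (w_orthz _ (wd_le (D i M)) gY (ltz_succ i)).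
  have [v <-] := dist_desc (dist_rot d) f0.
  have := in_shiftS (wd_le (D (i - 1) M)); rewrite subrK => lS.
  by rewrite (w_orthz v lS gY (ltz_succ i)) comp0l.
apply: wge_orth => Y f lY.
have f0 : gr_out (E i M) ∘ f = 0.
  have c0 := dist_comp0 (dist_rot (dist_rot d)).
  have a0 : (- fmap shift (wla (D (i - 1) M))) ∘ (gr_out (E i M) ∘ f) = 0.
    rewrite -w_inK fmapM compNl -compA (compA _ (gr_out _)).
    move: c0; rewrite compNl => /eqP; rewrite oppr_eq0 => /eqP ->.
    by rewrite comp0l comp0r oppr0.
  have [v <-] := dist_lift (dist_rot (dist_rot (wd_dist (D (i - 1) M)))) a0.
  have := wd_ge (D (i - 1) M); rewrite subrK => gR.
  by rewrite (w_orthz v lY gR (ltz_pred i)) comp0r.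
have [u Eu] := dist_lift (dist_rot d) f0.
have [u' Eu'] := wl_lift (D (i - 1) M) (wla (D i M) ∘ u) lY (lexx _).
have : u - w_in i M ∘ u' = 0.
  apply: (wl_uniq lY (ltz_pred i)).
  by rewrite compBr compA w_inK Eu' subrr.
move/eqP; rewrite subr_eq0 => /eqP Eu2.
by rewrite -Eu Eu2 compA (dist_comp0 d) comp0l.
Qed.

Lemma weq_shiftz i j X : weq w i X -> weq w (i + j) (shiftz C j X).
Proof.
suff h P : in_shift P i X -> in_shift P (i + j) (shiftz C j X).
  by move=> [lX gX]; split; exact: h.
move=> PX; elim/int_ind: j => [|n IH|n IH]; first by rewrite addr0.
  have -> : i + n.+1%:Z = i + n%:Z + 1 by rewrite intS (addrC 1) addrA.
  exact: in_shiftS.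
have -> : - n.+1%:Z = - n%:Z - 1 by rewrite intS opprD addrC.
rewrite addrA; apply: in_shift_isom (in_shiftU IH).
exact: isom_sym (unshift_shiftz _ _).
Qed.

Lemma wcx_weq p M : weq w 0 (shiftz C p (gr (E (- p) M))).
Proof. by have := weq_shiftz p (gr_weq (- p) M); rewrite addNr. Qed.

Definition wcx (p : int) M : heart w := exist _ _ (wcx_weq p M).

Definition gr_bd i M : Hom (gr (E i M)) (shift (gr (E (i - 1) M))) :=
  fmap shift (gr_in (E (i - 1) M)) ∘ gr_out (E i M).

Definition unit_inv (X : C) : Hom (unshift (shift X)) X :=
  sval (cid (ni_iso shift_unit X)).

(* The differentials M^0 -> M^1 and M^{-1} -> M^0 (the other ones do not enter
   the homology at M^0); the second one is the shift by [-1] of M_1 -> M_0[1],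
   followed by the identification of M_0[1][-1] with M_0. *)
Definition wcx_d0 M : Hom (wcx 0 M) (wcx 1 M) := gr_bd 0 M.
Definition wcx_dm1 M : Hom (wcx (-1) M) (wcx 0 M) :=
  unit_inv (gr (E 0 M)) ∘ fmap unshift (gr_bd 1 M).

Lemma unit_invK X : unit_inv X ∘ ni_map shift_unit X = idm X.
Proof. by have [] := svalP (cid (ni_iso shift_unit X)). Qed.
Lemma unit_Kinv X : ni_map shift_unit X ∘ unit_inv X = idm (unshift (shift X)).
Proof. by have [] := svalP (cid (ni_iso shift_unit X)). Qed.
Lemma unit_inv_nat X Y (f : Hom X Y) :
  unit_inv Y ∘ fmap unshift (fmap shift f) = f ∘ unit_inv X.
Proof.
apply: (is_iso_epi (ni_iso shift_unit X)).
rewrite -!compA unit_invK compm1.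
by rewrite -[fmap unshift _ ∘ _](ni_nat shift_unit f) compA unit_invK comp1m.
Qed.

Lemma gr_out_in i M : gr_out (E i M) ∘ gr_in (E i M) = 0.
Proof. exact: dist_comp0 (dist_rot (gr_dist (E i M))). Qed.

Lemma wcx_d0_dm1 M : wcx_d0 M ∘ wcx_dm1 M = 0.
Proof.
have bb : fmap shift (gr_bd 0 M) ∘ gr_bd 1 M = 0.
  rewrite /gr_bd compA -fmapM -compA.
  by have := gr_out_in 0 M => ->; rewrite comp0r fmap0 comp0l.
rewrite /comp /= -/(comp _ _) /wcx_d0 /wcx_dm1 compA -unit_inv_nat -compA -fmapM.
by rewrite bb fmap0 comp0r.
Qed.

(* f is a component M_i -> N_i of a morphism of weight complexes induced by g *)
Definition gr_mor i M N (g : Hom M N) (f : Hom (gr (E i M)) (gr (E i N))) : Prop :=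
  exists (a : Hom (wl (D i M)) (wl (D i N)))
         (b : Hom (wl (D (i - 1) M)) (wl (D (i - 1) N))),
    [/\ wla (D i N) ∘ a = g ∘ wla (D i M),
        wla (D (i - 1) N) ∘ b = g ∘ wla (D (i - 1) M),
        f ∘ gr_in (E i M) = gr_in (E i N) ∘ a
      & fmap shift b ∘ gr_out (E i M) = gr_out (E i N) ∘ f].

Lemma gr_mor_lift i M N (g : Hom M N)
    (a : Hom (wl (D i M)) (wl (D i N)))
    (b : Hom (wl (D (i - 1) M)) (wl (D (i - 1) N))) :
  wla (D i N) ∘ a = g ∘ wla (D i M) ->
  wla (D (i - 1) N) ∘ b = g ∘ wla (D (i - 1) M) ->
  exists f : Hom (gr (E i M)) (gr (E i N)),
    f ∘ gr_in (E i M) = gr_in (E i N) ∘ a /\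
    fmap shift b ∘ gr_out (E i M) = gr_out (E i N) ∘ f.
Proof.
move=> Ea Eb; apply: tri_mor (gr_dist (E i M)) (gr_dist (E i N)) _.
apply/eqP; rewrite -subr_eq0; apply/eqP.
apply: (wl_uniq (wd_le (D (i - 1) M)) (ltz_pred i)).
by rewrite compBr !compA Ea w_inK Eb -compA w_inK subrr.
Qed.

Lemma wla_lift i M N (g : Hom M N) : exists a : Hom (wl (D i M)) (wl (D i N)),
  wla (D i N) ∘ a = g ∘ wla (D i M).
Proof. exact: wl_lift (wd_le (D i M)) (lexx _). Qed.

Lemma gr_mor_ex i M N (g : Hom M N) : exists f, gr_mor (i := i) g f.
Proof.
have [a Ea] := wla_lift i g; have [b Eb] := wla_lift (i - 1) g.
by have [f [Ef Ef']] := gr_mor_lift Ea Eb; exists f, a, b.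
Qed.

Lemma gr_mor1 i M : gr_mor (i := i) (idm M) (idm _).
Proof.
by exists (idm _), (idm _); rewrite ?fmap1 !comp1m !compm1.
Qed.

Lemma gr_morM i L M N (g : Hom M N) (h : Hom L M) f f' :
  gr_mor (i := i) g f -> gr_mor (i := i) h f' -> gr_mor (i := i) (g ∘ h) (f ∘ f').
Proof.
move=> [a [b [E1 E2 E3 E4]]] [a' [b' [F1 F2 F3 F4]]]; exists (a ∘ a'), (b ∘ b').
split.
- by rewrite compA E1 -compA F1 compA.
- by rewrite compA E2 -compA F2 compA.
- by rewrite -compA F3 compA E3 compA.
by rewrite fmapM -compA F4 compA E4 compA.
Qed.

Lemma gr_morD i M N (g h : Hom M N) f f' :
  gr_mor (i := i) g f -> gr_mor (i := i) h f' -> gr_mor (i := i) (g + h) (f + f').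
Proof.
move=> [a [b [E1 E2 E3 E4]]] [a' [b' [F1 F2 F3 F4]]]; exists (a + a'), (b + b').
split.
- by rewrite compDr E1 F1 compDl.
- by rewrite compDr E2 F2 compDl.
- by rewrite compDl E3 F3 compDr.
by rewrite fmapD compDl E4 F4 compDr.
Qed.

Lemma gr_morN i M N (g : Hom M N) f :
  gr_mor (i := i) g f -> gr_mor (i := i) (- g) (- f).
Proof.
move=> [a [b [E1 E2 E3 E4]]]; exists (- a), (- b).
by rewrite fmapN !compNl !compNr E1 E2 E3 E4.
Qed.

Lemma gr_mor_d0 M N (g : Hom M N) (f : Hom (wcx 0 M) (wcx 0 N)) :
  gr_mor (i := 0) g f ->
  exists f1 : Hom (wcx 1 M) (wcx 1 N), wcx_d0 N ∘ f = f1 ∘ wcx_d0 M.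
Proof.
move=> [a [b [E1 E2 E3 E4]]]; have [c Ec] := wla_lift (0 - 1 - 1) g.
have [k [Ek Ek']] := gr_mor_lift E2 Ec.
have H : gr_bd 0 N ∘ f = fmap shift k ∘ gr_bd 0 M.
  by rewrite /gr_bd compA -fmapM Ek fmapM -!compA E4.
by exists (fmap shift k).
Qed.

Lemma gr_mor_dm1 M N (g : Hom M N) (f : Hom (wcx 0 M) (wcx 0 N)) :
  gr_mor (i := 0) g f ->
  exists f1 : Hom (wcx (-1) M) (wcx (-1) N), wcx_dm1 N ∘ f1 = f ∘ wcx_dm1 M.
Proof.
move=> [a [b [E1 E2 E3 E4]]]; have [c Ec] := wla_lift 1 g.
have [k [Ek Ek']] := @gr_mor_lift 1 _ _ _ c a Ec E1.
have H : gr_bd 1 N ∘ k = fmap shift f ∘ gr_bd 1 M.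
  rewrite /gr_bd -compA -Ek' !compA -!fmapM.
  by congr (fmap _ _ ∘ _); rewrite -E3.
exists (fmap unshift k); rewrite /comp /= -/(comp _ _) /wcx_dm1.
by rewrite -compA -fmapM H fmapM !compA unit_inv_nat.
Qed.

(* Morphisms of weight complexes inducing 0 are weakly homotopic to 0 *)
Lemma gr_mor0 M N (f : Hom (wcx 0 M) (wcx 0 N)) :
  gr_mor (i := 0) (0 : Hom M N) f ->
  exists (s : Hom (wcx 0 M) (wcx (-1) N)) (t : Hom (wcx 1 M) (wcx 0 N)),
    f = wcx_dm1 N ∘ s + t ∘ wcx_d0 M.
Proof.
move=> [a [b [E1 _ E3 _]]]; rewrite comp0l in E1.
have t1 := gr_dist (E 1 N).
have c0 : w_in 1 N ∘ a = 0.
  apply: (@wl_uniq C w 0 1 N (D 1 N) (wl (D 0 M)) _ (wd_le _) ltr01).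
  by rewrite compA w_inK; exact: E1.
have Sc0 : (- fmap shift (w_in 1 N)) ∘ fmap shift a = 0.
  by rewrite compNl -fmapM c0 fmap0 oppr0.
have [v Ev] := dist_lift (dist_rot (dist_rot t1)) Sc0.
pose s0 : Hom (wl (D 0 M)) (unshift (gr (E 1 N))) :=
  fmap unshift v ∘ ni_map shift_unit (wl (D 0 M)).
have Es0 : unit_inv (wl (D 0 N)) ∘ fmap unshift (gr_out (E 1 N)) ∘ s0 = a.
  rewrite /s0 compA -(compA (unit_inv _)) -fmapM Ev unit_inv_nat.
  by rewrite -compA unit_invK compm1.
have g1 : wge w 0 (unshift (gr (E 1 N))) by exact: in_shiftU (gr_weq 1 N).2.
have s00 : s0 ∘ w_in 0 M = 0.
  exact: (w_orthz _ (wd_le (D (0 - 1) M)) g1 (ltz_pred 0)).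
have [s Es] := dist_desc (gr_dist (E 0 M)) s00.
pose q : Hom (unshift (gr (E 1 N))) (wl (D 0 N)) :=
  unit_inv (wl (D 0 N)) ∘ fmap unshift (gr_out (E 1 N)).
pose dm : Hom (unshift (gr (E 1 N))) (gr (E 0 N)) := wcx_dm1 N.
pose f' : Hom (gr (E 0 M)) (gr (E 0 N)) := f.
have Ed : dm = gr_in (E 0 N) ∘ q.
  pose o : Hom (gr (E 1 N)) (shift (wl (D 0 N))) := gr_out (E 1 N).
  transitivity (unit_inv (gr (E 0 N)) ∘
      (fmap unshift (fmap shift (gr_in (E 0 N))) ∘ fmap unshift o)).
    exact: (congr1 (comp (unit_inv (gr (E 0 N))))
      (fmapM unshift (fmap shift (gr_in (E 0 N))) o)).
  by rewrite compA unit_inv_nat -compA.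
have Eqs : q ∘ s0 = a by exact: Es0.
have f0 : (f' - dm ∘ s) ∘ gr_in (E 0 M) = 0.
  by rewrite compBl E3 -compA Es Ed -compA Eqs subrr.
have [t0 Et0] := dist_desc (dist_rot (gr_dist (E 0 M))) f0.
have t2 := dist_rot (dist_rot (dist_rot (gr_dist (E (0 - 1) M)))).
have t00 : t0 ∘ (- fmap shift (w_in (0 - 1) M)) = 0.
  have lS := in_shiftS (wd_le (D (0 - 1 - 1) M)).
  exact: (@w_orthz C w (0 - 1 - 1 + 1) 0 _ _ _ lS (gr_weq 0 N).2 isT).
have [t Et] := dist_desc t2 t00.
exists s, (- t).
have H : f' = dm ∘ s + (- t) ∘ gr_bd 0 M.
  by rewrite /gr_bd compA compNl -compNr Et Et0 addrC subrK.
exact: H.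
Qed.
End WeightComplex.

Section PureFunctor.
Variables (C : tricat) (w : weight_structure C) (D : wd_choice w).
Variable E : wcone_choice D.
Variables (A : abcat) (F : cofunctor (heart w) A).
Implicit Types L M N : C.

Fact pure_cplx M : cmap F (wcx_dm1 E M) ∘ cmap F (wcx_d0 E M) = 0.
Proof. by rewrite -cmapM wcx_d0_dm1 cmap0. Qed.

(* The homology of F(M^1) -> F(M^0) -> F(M^{-1}) at F(M^0) *)
Definition pure_obj M : A := homology (pure_cplx M).

Definition pure_ind M N (f : Hom (wcx E 0 M) (wcx E 0 N))
    (t : Hom (pure_obj N) (pure_obj M)) : Prop :=
  homology_ind (gf := pure_cplx N) (gf' := pure_cplx M) (cmap F f) t.

Lemma pure_map_ex M N (g : Hom M N) : exists t : Hom (pure_obj N) (pure_obj M),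
  exists f : Hom (wcx E 0 M) (wcx E 0 N),
    gr_mor (E := E) (i := 0) g f /\ pure_ind f t.
Proof.
have [f0 f0P] := gr_mor_ex E 0 g.
pose f : Hom (wcx E 0 M) (wcx E 0 N) := f0; have fP : gr_mor (i := 0) g f := f0P.
have [f1 Ef1] := gr_mor_d0 (f := f) fP; have [f2 Ef2] := gr_mor_dm1 (f := f) fP.
have Ex : cmap F (wcx_d0 E M) ∘ cmap F f1 = cmap F f ∘ cmap F (wcx_d0 E N).
  by rewrite -!cmapM Ef1.
have Ez : cmap F f2 ∘ cmap F (wcx_dm1 E N) = cmap F (wcx_dm1 E M) ∘ cmap F f.
  by rewrite -!cmapM Ef2.
have [t tP] := homology_ind_ex (pure_cplx N) (pure_cplx M) Ex Ez.
by exists t, f.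
Qed.

(* The morphism induced by any morphism of weight complexes over g *)
Definition pure_map M N (g : Hom M N) : Hom (pure_obj N) (pure_obj M) :=
  sval (cid (pure_map_ex g)).

Lemma pure_map_uniq M N (g : Hom M N) (f : Hom (wcx E 0 M) (wcx E 0 N)) t :
  gr_mor (E := E) (i := 0) g f -> pure_ind f t -> t = pure_map g.
Proof.
move=> fP tP; have [f' [fP' tP']] := svalP (cid (pure_map_ex g)).
rewrite -/(pure_map g) in tP'.
have := gr_morD fP (gr_morN fP'); rewrite subrr => /(@gr_mor0 _ _ _ E)[s [r Esr]].
have tN : pure_ind (f - f') (t - pure_map g).
  by rewrite /pure_ind cmapB; apply: homology_indD tP (homology_indN tP').
apply/eqP; rewrite -subr_eq0; apply/eqP.
apply: (homology_ind0 (s := cmap F r) (r := cmap F s) tN).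
by rewrite [f - f']Esr cmapD !cmapM addrC.
Qed.

Fact pure_map1 M : pure_map (idm M) = idm (pure_obj M).
Proof.
apply/esym/(@pure_map_uniq _ _ _ (idm _)); first exact: gr_mor1.
by rewrite /pure_ind cmap1; exact: homology_ind1.
Qed.

Fact pure_mapM L M N (g : Hom M N) (h : Hom L M) :
  pure_map (g ∘ h) = pure_map h ∘ pure_map g.
Proof.
have [f [fP tP]] := svalP (cid (pure_map_ex g)).
have [f' [fP' tP']] := svalP (cid (pure_map_ex h)).
apply/esym/(@pure_map_uniq _ _ _ (f ∘ f')); first exact: gr_morM fP fP'.
by rewrite /pure_ind cmapM; exact: homology_indM tP tP'.
Qed.

Fact pure_mapD M N (g h : Hom M N) :
  pure_map (g + h) = pure_map g + pure_map h.
Proof.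
have [f [fP tP]] := svalP (cid (pure_map_ex g)).
have [f' [fP' tP']] := svalP (cid (pure_map_ex h)).
apply/esym/(@pure_map_uniq _ _ _ (f + f')); first exact: gr_morD fP fP'.
by rewrite /pure_ind cmapD; exact: homology_indD tP tP'.
Qed.

Definition pure_functor : cofunctor C A :=
  @CoFunctor C A pure_obj pure_map pure_map1 pure_mapM pure_mapD.
End PureFunctor.

(* Main.v *)
(* Everything rests on orthogonality: a morphism from w_{<=i} into w_{>=i+1}
   vanishes, so maps between weight truncations of different levels are
   determined by their composites with M.  For the commutation of the two
   virtual truncations, the octahedron shows that w_{>=m} w_{<=n} M is also a
   choice of w_{<=n} w_{>=m} M, and the image of H of a map between two
   successive levels does not depend on such choices.
   A functor H of weight range [m,m] is recovered from its values on the heart: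
   H(M[m]) is the kernel of H(w_{<=0} M [m]) -> H(M^{-1}[m]), and the source is
   the cokernel of H(M^1[m]) -> H(M^0[m]).  Conversely, for a triangle
   X -> Y -> Z the complex of Z is, in the degrees that matter, the cone of that
   of X -> Y, which makes pure functors cohomological. *)
From mathcomp Require Import all_boot all_order all_algebra boolp zify.
Require Import Defs.

Set Implicit Arguments.
Unset Strict Implicit.
Unset Printing Implicit Defensive.

Import Order.TTheory GRing.Theory Num.Theory.
Local Open Scope ring_scope.

(** * Abelian categories *)

Section ZeroObjects.
Variable C : precat.
Implicit Types X Y Z : C.

(** Two truncations of the same level are joined by a morphism over [M] that need not be unique;
    only a strict rise of level makes it unique. This is why a virtual truncation is an image
    between two successive levels, and why comparison maps are required to be natural and mutually
    inverse only after composition with a transition map. The weight complex is likewise functorial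
    only up to weak homotopy [d s + t d], with unrelated [s] and [t]. So mapping cones are not
    compared as complexes: octahedra provide only the degree 0 components and those relations
    between them that homology sees. *)

Lemma zero_obj_idm X : idm X = 0 -> zero_obj X.
Proof.
move=> i0; split=> Y f; first by rewrite -[f]compm1 i0 comp0r.
by rewrite -[f]comp1m i0 comp0l.
Qed.

Lemma zero_obj_retract X Y : retract X Y -> zero_obj Y -> zero_obj X.
Proof.
by move=> [s [r rs]] [Y0 _]; apply: zero_obj_idm; rewrite -rs (Y0 _ r) comp0l.
Qed.

Lemma mono0 X Y (f : Hom X Y) :
  (forall W (u : Hom W X), f ∘ u = 0 -> u = 0) -> mono f.
Proof.
move=> h W u v E; apply/eqP; rewrite -subr_eq0; apply/eqP/h.
by rewrite compBr E subrr.
Qed.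

Lemma epi0 X Y (f : Hom X Y) :
  (forall W (u : Hom Y W), u ∘ f = 0 -> u = 0) -> epi f.
Proof.
move=> h W u v E; apply/eqP; rewrite -subr_eq0; apply/eqP/h.
by rewrite compBl E subrr.
Qed.

Lemma epi_eq0 X Y W (f : Hom X Y) (u : Hom Y W) : epi f -> u ∘ f = 0 -> u = 0.
Proof. by move=> ef uf; apply: ef; rewrite uf comp0l. Qed.

Lemma mono_eq0 X Y W (f : Hom X Y) (u : Hom W X) : mono f -> f ∘ u = 0 -> u = 0.
Proof. by move=> ef uf; apply: ef; rewrite uf comp0r. Qed.

Lemma epi_comp X Y Z (f : Hom X Y) (g : Hom Y Z) : epi f -> epi g -> epi (g ∘ f).
Proof. by move=> ef eg W u v; rewrite !compA => /ef/eg. Qed.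

Lemma mono_comp X Y Z (f : Hom X Y) (g : Hom Y Z) : mono f -> mono g -> mono (g ∘ f).
Proof. by move=> mf mg W u v; rewrite -!compA => /mg/mf. Qed.

Lemma epi_cancel X Y Z (f : Hom X Y) (g : Hom Y Z) : epi (g ∘ f) -> epi g.
Proof. by move=> e W u v E; apply: e; rewrite !compA E. Qed.

Lemma mono_cancel X Y Z (f : Hom X Y) (g : Hom Y Z) : mono (g ∘ f) -> mono f.
Proof. by move=> e W u v E; apply: e; rewrite -!compA E. Qed.
End ZeroObjects.

(* Elements of an object Y of A are handled as morphisms W -> Y, up to
   refinement of W along epimorphisms. *)
Section Abelian.
Variable A : abcat.
Implicit Types X Y Z W : A.

(** The pullback is the kernel [k] of [phi = f p1 - u p2]. Being epi, [phi] is the cokernel of some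
    [g], and [g] factors through [k]. So if [v p2 k = 0] then [v p2 = s phi] for some [s];
    restriction to [X] gives [s f = 0], hence [s = 0]. *)
Lemma epi_pullback X Y W (f : Hom X Y) (u : Hom W Y) : epi f ->
  exists W' (e : Hom W' W) (x : Hom W' X), epi e /\ f ∘ x = u ∘ e.
Proof.
move=> ef; have [P [i1 [i2 [p1 [p2 [E11 E22 E12 E21 _]]]]]] := (ab_additive A).2 X W.
pose phi := f ∘ p1 - u ∘ p2.
have phi1 : phi ∘ i1 = f by rewrite compBl -!compA E11 E21 comp0r subr0 compm1.
have ephi : epi phi by apply: (@epi_cancel _ _ _ _ i1); rewrite phi1.
have [Z [g [pg gP]]] := ab_epi ephi.
have [K [k [pk kP]]] := ab_ker phi.
exists K, (p2 ∘ k), (p1 ∘ k); split; last first.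
  by apply/eqP; rewrite -subr_eq0 !compA -compBl pk.
apply: epi0 => V v; rewrite compA => vk.
have [g' [Eg _]] := kP _ _ pg.
have [|s [Es _]] := gP _ (v ∘ p2); first by rewrite -Eg compA vk comp0l.
have s0 : s = 0.
  apply: (epi_eq0 ef); rewrite -phi1 compA Es.
  by rewrite -compA E21 comp0r.
by rewrite -[v]compm1 -E22 compA -Es s0 !comp0l.
Qed.

Lemma mono_epi_iso X Y (f : Hom X Y) : mono f -> epi f -> is_iso f.
Proof.
move=> mf ef; have [Z [g [gf gP]]] := ab_mono mf.
have g0 : g = 0 by exact: epi_eq0 ef gf.
have [|s [Es _]] := gP _ (idm Y); first by rewrite g0 comp0l.
by exists s; split=> //; apply: mf; rewrite compA Es comp1m compm1.
Qed.

(** Descent: [j] is the kernel of some [p], and [p u e = p j x = 0] forces [p u = 0]. A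
    factorization found after refinement along [e] thus exists already on [W]. *)
Lemma mono_fill X Y W W' (j : Hom X Y) (e : Hom W' W) (u : Hom W Y) (x : Hom W' X) :
  mono j -> epi e -> j ∘ x = u ∘ e -> exists v : Hom W X, j ∘ v = u /\ v ∘ e = x.
Proof.
move=> mj ee E; have [Z [p [pj pP]]] := ab_mono mj.
have [|v [Ev _]] := pP _ u.
  by apply: (epi_eq0 ee); rewrite -compA -E compA pj comp0l.
by exists v; split=> //; apply: mj; rewrite compA Ev E.
Qed.

(** The image in [exact_at] comes with its own cokernel [q], so [u] is first carried over to the
    chosen image through [q0 = s q]; the local preimage is then a pullback along the epi
    [im_out f]. *)
Lemma exact_lift X Y Z W (f : Hom X Y) (g : Hom Y Z) (u : Hom W Y) :
  exact_at f g -> g ∘ u = 0 ->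
  exists W' (e : Hom W' W) (x : Hom W' X), epi e /\ f ∘ x = u ∘ e.
Proof.
move=> [I [i [[Q [q [[qf qP] [qi _]]]] [_ iP]]]] gu.
have [v [Ev _]] := iP _ _ gu.
have [Q0 [q0 [[q0f _] [_ jP]]]] := im_inP f.
have [s [Es _]] := qP _ _ q0f.
have [|v' [Ev' _]] := jP _ u.
  by rewrite -Es -compA -Ev (compA q) qi comp0l comp0r.
have [W' [e [x [ee Ex]]]] := epi_pullback v' (@im_out_epi _ _ _ f).
by exists W', e, x; rewrite -[in f ∘ x](im_inK f) -compA Ex compA Ev'.
Qed.

Lemma exact_atP X Y Z (f : Hom X Y) (g : Hom Y Z) : g ∘ f = 0 ->
  (forall W (u : Hom W Y), g ∘ u = 0 ->
     exists W' (e : Hom W' W) (x : Hom W' X), epi e /\ f ∘ x = u ∘ e) ->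
  exact_at f g.
Proof.
move=> gf h; exists (im f), (im_in f); split; first exact: im_inP.
split; first by apply: (epi_eq0 (@im_out_epi _ _ _ f)); rewrite -compA im_inK.
move=> W u /h[W' [e [x [ee Ex]]]].
have E : im_in f ∘ (im_out f ∘ x) = u ∘ e by rewrite compA im_inK.
have [v [Ev _]] := mono_fill (@im_in_mono _ _ _ f) ee E.
by exists v; split=> // v' Ev'; apply: (@im_in_mono _ _ _ f); rewrite Ev Ev'.
Qed.

Lemma cokernel_exact X Y Q (f : Hom X Y) (q : Hom Y Q) :
  is_cokernel f q -> exact_at f q.
Proof.
by move=> qP; have [I [i iP]] := ab_ker q; exists I, i; split=> //; exists Q, q.
Qed.

Lemma exact_mono X Y Z (f : Hom X Y) (g : Hom Y Z) :
  exact_at f g -> zero_obj X -> mono g.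
Proof.
move=> ex [_ X0]; apply: mono0 => W u gu.
have [W' [e [x [ee Ex]]]] := exact_lift ex gu.
by apply: (epi_eq0 ee); rewrite -Ex (X0 _ x) comp0r.
Qed.

Lemma exact_epi X Y Z (f : Hom X Y) (g : Hom Y Z) :
  exact_at f g -> zero_obj Z -> epi f.
Proof.
move=> ex [_ Z0]; have [W' [e [x [ee Ex]]]] := exact_lift (u := idm Y) ex (Z0 _ _).
by apply: (@epi_cancel _ _ _ _ x); rewrite Ex comp1m.
Qed.

Lemma exact_zero X Y Z (f : Hom X Y) (g : Hom Y Z) :
  exact_at f g -> zero_obj X -> zero_obj Z -> zero_obj Y.
Proof.
move=> ex X0 [_ Z0]; apply: zero_obj_idm; apply: (exact_mono ex X0).
by rewrite comp0r; exact: Z0.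
Qed.

(** * Cycles and homology classes as generalized elements *)

Section HomologyElements.
Variables (X Y Z : A) (f : Hom X Y) (g : Hom Y Z) (gf : g ∘ f = 0).

(** [u] is the class of the cycle [y]. A relation is used because a class has a representing cycle
    only after refinement of [W] ([represents_cover]). *)
Definition represents W (y : Hom W Y) (u : Hom W (homology gf)) : Prop :=
  exists l : Hom W (ker g), ker_in g ∘ l = y /\ homology_out gf ∘ l = u.

Lemma homology_out_epi : epi (homology_out gf).
Proof. exact: cokernel_epi (coker_outP _). Qed.

Lemma represents_ex W (y : Hom W Y) : g ∘ y = 0 -> exists u, represents y u.
Proof.
move=> gy; have [l [El _]] := (ker_inP g).2 _ _ gy.
by exists (homology_out gf ∘ l), l.
Qed.

Lemma represents_cover W (u : Hom W (homology gf)) :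
  exists W' (e : Hom W' W) y, epi e /\ represents y (u ∘ e).
Proof.
have [W' [e [l [ee El]]]] := epi_pullback u homology_out_epi.
by exists W', e, (ker_in g ∘ l); split=> //; exists l.
Qed.

Lemma represents_cycle W (y : Hom W Y) u : represents y u -> g ∘ y = 0.
Proof. by move=> [l [<- _]]; rewrite compA (ker_inP g).1 comp0l. Qed.

Lemma represents_uniq W (y : Hom W Y) u u' :
  represents y u -> represents y u' -> u = u'.
Proof.
move=> [l [<- <-]] [l' [E <-]]; congr (_ ∘ _).
exact/esym/(kernel_mono (ker_inP g)).
Qed.

Lemma represents_boundary W (x : Hom W X) : represents (f ∘ x) 0.
Proof.
exists (ker_lift gf ∘ x); rewrite !compA ker_liftK; split=> //.
by rewrite (coker_outP _).1 comp0l.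
Qed.

Lemma representsB W (y y' : Hom W Y) u u' :
  represents y u -> represents y' u' -> represents (y - y') (u - u').
Proof. by move=> [l [<- <-]] [l' [<- <-]]; exists (l - l'); rewrite !compBr. Qed.

Lemma represents_comp W W' (e : Hom W' W) (y : Hom W Y) u :
  represents y u -> represents (y ∘ e) (u ∘ e).
Proof. by move=> [l [<- <-]]; exists (l ∘ e); rewrite !compA. Qed.

Lemma represents0 W (y : Hom W Y) : represents y 0 ->
  exists W' (e : Hom W' W) (x : Hom W' X), epi e /\ f ∘ x = y ∘ e.
Proof.
move=> [l [<- hl]].
have [W' [e [x [ee Ex]]]] := exact_lift (cokernel_exact (coker_outP (ker_lift gf))) hl.
by exists W', e, x; split=> //; rewrite -compA -Ex compA ker_liftK.
Qed.
End HomologyElements.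

Lemma represents_ind X Y Z (f : Hom X Y) (g : Hom Y Z) (gf : g ∘ f = 0)
    X' Y' Z' (f' : Hom X' Y') (g' : Hom Y' Z') (gf' : g' ∘ f' = 0)
    (y : Hom Y Y') (t : Hom (homology gf) (homology gf'))
    W (v : Hom W Y) u :
  homology_ind y t -> represents v u -> represents (gf := gf') (y ∘ v) (t ∘ u).
Proof.
move=> [k [Ek Et]] [l [<- <-]]; exists (k ∘ l).
by rewrite !compA Ek Et.
Qed.
End Abelian.

(** * Cohomological functors *)

Section CofunctorIso.
Variables (C D : precat).
Implicit Types F G H : cofunctor C D.

Lemma cofunctor_iso_sym F G : cofunctor_iso F G -> cofunctor_iso G F.
Proof.
move=> [a [ai an]]; exists (fun X => sval (cid (ai X))); split=> [X|X Y f].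
  by case: (cid _) => b [ba ab]; exists (a X).
case: (cid _) => b [ba ab]; case: (cid _) => b' [ba' ab'] /=.
apply: (is_iso_mono (ai X)).
by rewrite compA ab comp1m compA an -compA ab' compm1.
Qed.

Lemma cofunctor_iso_trans G F H :
  cofunctor_iso F G -> cofunctor_iso G H -> cofunctor_iso F H.
Proof.
move=> [a [ai an]] [b [bi bn]]; exists (fun X => b X ∘ a X); split=> [X|X Y f].
  have [a' [a'a aa']] := ai X; have [b' [b'b bb']] := bi X; exists (a' ∘ b').
  by rewrite -compA (compA b') b'b comp1m a'a -compA (compA (a X)) aa' comp1m bb'.
by rewrite -compA an compA bn compA.
Qed.

Lemma cofunctor_iso_kills (P : C -> Prop) F G :
  cofunctor_iso F G -> kills F P -> kills G P.
Proof.
move=> [a [ai an]] kF X /kF; apply: zero_obj_retract.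
by have [b [ba ab]] := ai X; exists b, (a X).
Qed.

Lemma cofunctor_iso_zero F G :
  cofunctor_zero F -> cofunctor_zero G -> cofunctor_iso F G.
Proof.
move=> F0 G0; exists (fun X => 0); split=> [X|X Y f]; last first.
  by rewrite comp0l comp0r.
by exists 0; split; [have [h _] := F0 X | have [h _] := G0 X]; rewrite comp0l (h _ (idm _)).
Qed.
End CofunctorIso.

Lemma cofunctor_iso_cohomological (C : tricat) (A : abcat) (G H : cofunctor C A) :
  cofunctor_iso G H -> cohomological G -> cohomological H.
Proof.
move=> [a [ai an]] cG X Y Z f g h d; apply: exact_atP.
  by rewrite -cmapM (dist_comp0 d) cmap0.
move=> W u hu; have [b [ba ab]] := ai Y.
have gu : cmap G f ∘ (b ∘ u) = 0.
  apply: (is_iso_mono (ai X)); rewrite comp0r -hu compA an -!compA.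
  by rewrite (compA (a Y)) ab comp1m.
have [W' [e [x [ee Ex]]]] := exact_lift (cG _ _ _ _ _ _ d) gu.
exists W', e, (a Z ∘ x); split=> //.
by rewrite compA -an -compA Ex !compA ab comp1m.
Qed.

(* F is the image of d : S -> U, and F' that of d' : S' -> U'. *)
Section PresentedFunctors.
Variables (C : precat) (A : abcat) (F F' : cofunctor C A) (S U S' U' : C -> A).
Variable k : forall M, Hom (S M) (F M).
Variable j : forall M, Hom (F M) (U M).
Variable k' : forall M, Hom (S' M) (F' M).
Variable j' : forall M, Hom (F' M) (U' M).
Hypothesis k_epi : forall M, epi (k M).
Hypothesis k'_epi : forall M, epi (k' M).
Hypothesis j_mono : forall M, mono (j M).
Hypothesis j'_mono : forall M, mono (j' M).
Variable u : forall M, Hom (S M) (S' M).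
Variable u' : forall M, Hom (S' M) (S M).
Variable v : forall M, Hom (U M) (U' M).
Variable v' : forall M, Hom (U' M) (U M).
Variable d : forall M N : C, Hom M N -> Hom (S N) (U M).
Variable d' : forall M N : C, Hom M N -> Hom (S' N) (U' M).
Hypothesis dE : forall M N (g : Hom M N), j M ∘ cmap F g ∘ k N = d g.
Hypothesis dE' : forall M N (g : Hom M N), j' M ∘ cmap F' g ∘ k' N = d' g.
Hypothesis vd : forall M N (g : Hom M N), v M ∘ d g = d' g ∘ u N.
Hypothesis vd' : forall M N (g : Hom M N), v' M ∘ d' g = d g ∘ u' N.
Hypothesis v'v : forall M, v' M ∘ v M ∘ d (idm M) = d (idm M).
Hypothesis vv' : forall M, v M ∘ v' M ∘ d' (idm M) = d' (idm M).

(** The [v] and [v'] need not be inverse to each other: as [k] is epi and [j] mono, it is enough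
    that [v' v] and [v v'] act trivially on [d] and [d']. No more than this is available for
    truncations of equal level. *)
Lemma presented_iso : cofunctor_iso F F'.
Proof.
have d1 M : d (idm M) = j M ∘ k M by rewrite -dE cmap1 compm1.
have d'1 M : d' (idm M) = j' M ∘ k' M by rewrite -dE' cmap1 compm1.
have tP M : exists t : Hom (F M) (F' M), j' M ∘ t = v M ∘ j M.
  have [|t [Et _]] := mono_fill (j := j' M) (e := k M) (u := v M ∘ j M)
    (x := k' M ∘ u M) (@j'_mono M) (@k_epi M).
    by rewrite compA -d'1 -compA -d1 vd.
  by exists t.
have tP' M : exists t : Hom (F' M) (F M), j M ∘ t = v' M ∘ j' M.
  have [|t [Et _]] := mono_fill (j := j M) (e := k' M) (u := v' M ∘ j' M)
    (x := k M ∘ u' M) (@j_mono M) (@k'_epi M).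
    by rewrite compA -d1 -compA -d'1 vd'.
  by exists t.
exists (fun M => sval (cid (tP M))); split=> [M|M N g]; last first.
  case: (cid _) => t Et; case: (cid _) => t' Et' /=.
  have Ek : t' ∘ k N = k' N ∘ u N.
    by apply: (@j'_mono N); rewrite !compA Et' -compA -d1 vd d'1.
  apply: (@j'_mono M); apply: (@k_epi N).
  rewrite !compA Et -[_ ∘ t' ∘ _]compA Ek.
  by have := vd g; rewrite -dE -dE' !compA.
case: (cid _) => t Et /=; have [t' Et'] := tP' M; exists t'; split.
  apply: (@j_mono M); apply: (@k_epi M); rewrite compm1 -d1 -v'v d1.
  by rewrite !compA Et' -(compA (v' M)) Et !compA.
apply: (@j'_mono M); apply: (@k'_epi M); rewrite compm1 -d'1 -vv' d'1.
by rewrite !compA Et -(compA (v M)) Et' !compA.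
Qed.
End PresentedFunctors.

(** * Rotations and shifts of distinguished triangles *)

Section Triangles.
Variable C : tricat.
Implicit Types X Y Z W : C.

Lemma isoN X Y (f : Hom X Y) : is_iso f -> is_iso (- f).
Proof. by move=> [g [gf fg]]; exists (- g); rewrite !compNl !compNr !opprK. Qed.

Lemma iso_idm (D : precat) (X : D) : is_iso (idm X).
Proof. by exists (idm X); rewrite comp1m. Qed.

(** Three rotations put a sign on all three morphisms; [- idm] on the middle object removes it from
    the first two. *)
Lemma dist_shift X Y Z (f : Hom X Y) (g : Hom Y Z) h :
  dist f g h -> dist (fmap shift f) (fmap shift g) (- fmap shift h).
Proof.
move=> /dist_rot/dist_rot/dist_rot d.
apply: tri_iso (d); [exact: iso_idm|exact/isoN/iso_idm|exact: iso_idm|..].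
- by rewrite compNl compNr comp1m opprK compm1.
- by rewrite !compNr comp1m compm1.
by rewrite fmap1 comp1m compm1.
Qed.

(* The last morphism is left unspecified because shift_unit and shift_counit
   are not assumed to satisfy the triangle identities. *)
Lemma dist_unrot X Y Z (f : Hom X Y) (g : Hom Y Z) h :
  dist f g h -> exists g', dist (unit_inv X ∘ fmap unshift h) f g'.
Proof.
move=> d; have ci := ni_iso shift_counit Z.
have [c [ec ce]] := ci; set e := ni_map shift_counit Z in ec ce ci.
have [u Eu] := @shift_full C _ _ (h ∘ e).
have ciI : is_iso c by exists e.
(* Replacing [Z] by [Z[-1][1]] makes the last morphism a shift, [h e = u[1]], so that [tri_rot] can
   be read backwards. The automorphism [a] of [Z[-1]] then relates [- u] to the required first
   morphism. *)
have d1 : dist f (c ∘ g) (- fmap shift (- u)).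
  apply: tri_iso d; [exact: iso_idm|exact: iso_idm|exact: ciI|..].
  - by rewrite compm1 comp1m.
  - by rewrite compm1.
  by rewrite fmap1 comp1m fmapN opprK Eu -compA ce compm1.
have d2 : dist (- u) f (c ∘ g) by apply/tri_rot.
pose a := - (fmap unshift e ∘ ni_map shift_unit (unshift Z)).
have ai : is_iso a.
  apply: isoN; have [s [s1 s2]] := ni_iso shift_unit (unshift Z).
  exists (s ∘ fmap unshift c); split.
    rewrite -compA (compA (fmap unshift c)) -fmapM ec fmap1.
    by rewrite comp1m.
  rewrite -compA (compA _ s) s2  comp1m -[_ ∘ fmap unshift c]fmapM ce; exact: fmap1.
exists (fmap shift a ∘ (c ∘ g)).
apply: tri_iso d2; [exact: ai|exact: iso_idm|exact: iso_idm|..].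
- rewrite comp1m /a compNr; congr (- _).
  rewrite -compA (compA (fmap unshift h)) -fmapM -Eu compA unit_inv_nat.
  by rewrite -compA unit_invK compm1.
- by rewrite comp1m compm1.
by rewrite compm1.
Qed.

Section Exact.
Variables (A : abcat) (H : cofunctor C A).
Hypothesis cH : cohomological H.
Variables (X Y Z : C) (f : Hom X Y) (g : Hom Y Z) (h : Hom Z (shift X)).
Hypothesis d : dist f g h.

Lemma cohom_zero : zero_obj (H X) -> zero_obj (H Z) -> zero_obj (H Y).
Proof. by move=> X0 Z0; apply: exact_zero (cH d) _ _. Qed.

Lemma cohom_mono : zero_obj (H Z) -> mono (cmap H f).
Proof. exact: exact_mono (cH d). Qed.

Lemma cohom_epi : zero_obj (H X) -> epi (cmap H g).
Proof. exact: exact_epi (cH d). Qed.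

Lemma cohom_mono_shift : zero_obj (H (shift X)) -> mono (cmap H g).
Proof. exact: exact_mono (cH (dist_rot d)). Qed.

Lemma cohom_epi_unshift : zero_obj (H (unshift Z)) -> epi (cmap H f).
Proof. by have [g' d'] := dist_unrot d; exact: exact_epi (cH d'). Qed.
End Exact.

Lemma cohom_shift (A : abcat) (H : cofunctor C A) :
  cohomological H -> cohomological (ccomp H shift).
Proof. by move=> cH X Y Z f g h /dist_shift/cH. Qed.

(** The triangle itself is not shifted by [[-1]]. Exactness is tested on the cone [Z'] of [f[-1]],
    and the preimage in [H Z'] is moved to [H (Z[-1])] along a morphism [s : Z[-1] -> Z'] with [s
    g[-1] = g']. *)
Lemma cohom_unshift (A : abcat) (H : cofunctor C A) :
  cohomological H -> cohomological (ccomp H unshift).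
Proof.
move=> cH X Y Z f g h d; apply: exact_atP.
  by rewrite -cmapM (dist_comp0 d) cmap0.
move=> W u hu; have [Z' [g' [h' d']]] := tri_cone (fmap unshift f).
have [W' [e [x [ee Ex]]]] := exact_lift (cH _ _ _ _ _ _ d') hu.
exists W', e.
pose cX := ni_map shift_counit X; pose cY := ni_map shift_counit Y.
have E : cY ∘ fmap shift (fmap unshift f) = f ∘ cX := ni_nat shift_counit f.
have [b [bcY cYb]] := ni_iso shift_counit Y.
have E' : fmap shift g' ∘ b ∘ f = 0.
  apply: (is_iso_epi (ni_iso shift_counit X)).
  rewrite -!compA -[f ∘ _]E (compA b) bcY comp1m comp0l.
  have := fmapM shift g' (fmap unshift f); rewrite (dist_comp0 d') fmap0.
  exact: esym.
have [v Ev] := dist_desc d E'.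
have [s Es] := @shift_full C _ _ (v ∘ ni_map shift_counit Z).
exists (cmap H s ∘ x); split=> //; rewrite -Ex compA.
rewrite -[cmap _ g]/(cmap H (fmap unshift g)) -cmapM.
congr (cmap H _ ∘ _); apply: shift_faithful.
rewrite fmapM Es -compA [_ ∘ fmap shift _](ni_nat shift_counit g) compA Ev.
by rewrite -compA bcY compm1.
Qed.
End Triangles.

(** * Weight classes and virtual truncations *)

Section Weights.
Variables (C : tricat) (w : weight_structure C) (D : wd_choice w).
Implicit Types (X Y Z M N : C) (i j k : int).

Lemma wle_le i j X : i <= j -> wle w i X -> wle w j X.
Proof.
move=> ij lX; apply: (wle_orth D) => Y f gY.
by apply: w_orthz lX gY _; rewrite ltzD1.
Qed.

Lemma wge_le i j X : i <= j -> wge w j X -> wge w i X.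
Proof.
move=> ij gX; apply: (wge_orth D) => Y f lY.
by apply: w_orthz lY gX _; rewrite ltrBlDr ltzD1.
Qed.

Lemma wle_ext i X Y Z (f : Hom X Y) (g : Hom Y Z) h :
  dist f g h -> wle w i X -> wle w i Z -> wle w i Y.
Proof.
move=> d lX lZ; apply: (wle_orth D) => T u gT.
have [v <-] := dist_desc d (w_orthz (u ∘ f) lX gT (ltz_succ i)).
by rewrite (w_orthz v lZ gT (ltz_succ i)) comp0l.
Qed.

Lemma wge_ext i X Y Z (f : Hom X Y) (g : Hom Y Z) h :
  dist f g h -> wge w i X -> wge w i Z -> wge w i Y.
Proof.
move=> d gX gZ; apply: (wge_orth D) => T u lT.
have [v <-] := dist_lift d (w_orthz (g ∘ u) lT gZ (ltz_pred i)).
by rewrite (w_orthz v lT gX (ltz_pred i)) comp0r.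
Qed.

Lemma wle_shift i X : wle w (i - 1) X -> wle w i (shift X).
Proof. by move/in_shiftS; rewrite subrK. Qed.

Lemma wge_unshift i X : wge w (i + 1) X -> wge w i (unshift X).
Proof. by move/in_shiftU; rewrite addrK. Qed.

Lemma wle_cone i X Y Z (f : Hom X Y) (g : Hom Y Z) h :
  dist f g h -> wle w (i - 1) X -> wle w i Y -> wle w i Z.
Proof. by move=> d /wle_shift lX lY; exact: wle_ext (dist_rot d) lY lX. Qed.

Lemma wge_cocone i X Y Z (f : Hom X Y) (g : Hom Y Z) h :
  dist f g h -> wge w i Y -> wge w (i + 1) Z -> wge w i X.
Proof.
by move=> d gY /wge_unshift gZ; have [g' d'] := dist_unrot d; exact: wge_ext d' gZ gY.
Qed.

Section Cofunctors.
Variables (A : abcat) (H : cofunctor C A).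
Hypothesis cH : cohomological H.
Implicit Types m n : int.

Lemma weight_range_zero m n : n < m -> weight_range w H m n -> cofunctor_zero H.
Proof.
move=> nm [Hm Hn] M; apply: (cohom_zero cH (wd_dist (D n M))).
  by apply: Hm; apply: wle_le (wd_le _); rewrite lerBrDr lezD1.
by apply: Hn; exact: wd_ge.
Qed.

Lemma weight_range_epi m M (d : wdec w (m - 1) M) :
  weight_range_ge w H m -> epi (cmap H (wrb d)).
Proof. by move=> Hm; apply: (cohom_epi cH (wd_dist d)); apply: Hm; exact: wd_le. Qed.

Lemma weight_range_mono n M (d : wdec w n M) :
  weight_range_le w H n -> mono (cmap H (wla d)).
Proof. by move=> Hn; apply: (cohom_mono cH (wd_dist d)); apply: Hn; exact: wd_ge. Qed.

(** Induction on [p]: the [(n+1+p)]-decomposition of [Y] splits off a piece of weight exactly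
    [n+1+p+1] and leaves one with weights between [n+1] and [n+1+p]. Boundedness supplies the
    initial [p]; [absz] also covers [k < n + 1]. *)
Lemma bounded_range_le n : bounded w ->
  weight_range_le w H n <-> forall i, n < i -> kills H (weq w i).
Proof.
move=> bw; split=> [Hn i ni X [_ gX]|Hi X gX].
  by apply: Hn; apply: wge_le gX; rewrite lezD1.
have [[k lX] _] := bw X.
suff h (p : nat) Y : wge w (n + 1) Y -> wle w (n + 1 + p%:Z) Y -> zero_obj (H Y).
  apply: (h (absz (k - (n + 1))%R) X gX); apply: wle_le lX; lia.
elim: p Y => [|p IH] Y gY lY.
  by apply: (Hi (n + 1) _ Y); [lia | split=> //; move: lY; rewrite addr0].
have d := D (n + 1 + p%:Z) Y; apply: (cohom_zero cH (wd_dist d)).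
  apply: IH (wd_le d); apply: wge_cocone (wd_dist d) gY _.
  by apply: wge_le (wd_ge d); lia.
apply: (Hi (n + 1 + p.+1%:Z)); first by lia.
split.
  by apply: wle_cone (wd_dist d) _ lY; apply: wle_le (wd_le d); lia.
by apply: wge_le (wd_ge d); lia.
Qed.

Lemma bounded_range_ge m : bounded w ->
  weight_range_ge w H m <-> forall i, i < m -> kills H (weq w i).
Proof.
move=> bw; split=> [Hm i im X [lX _]|Hi X lX].
  by apply: Hm; apply: wle_le lX; rewrite lerBrDr lezD1.
have [_ [k gX]] := bw X.
suff h (p : nat) Y : wle w (m - 1) Y -> wge w (m - 1 - p%:Z) Y -> zero_obj (H Y).
  apply: (h (absz (m - 1 - k)%R) X lX); apply: wge_le gX; lia.
elim: p Y => [|p IH] Y lY gY.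
  by apply: (Hi (m - 1) _ Y); [lia | split=> //; move: gY; rewrite subr0].
have d := D (m - 1 - p.+1%:Z) Y; apply: (cohom_zero cH (wd_dist d)).
  apply: (Hi (m - 1 - p.+1%:Z)); first by lia.
  split; first exact: wd_le.
  by apply: wge_cocone (wd_dist d) gY (wd_ge d).
apply: IH; last by apply: wge_le (wd_ge d); lia.
apply: wle_cone (wd_dist d) _ lY.
by apply: wle_le (wd_le d); lia.
Qed.
End Cofunctors.

(** * Weight ranges of virtual truncations, and recovery of [H] from them *)

Section VirtualTruncations.
Variables (A : abcat) (H : cofunctor C A).
Implicit Types m n : int.

Lemma im_zero (X Y : A) (f : Hom X Y) : f = 0 -> zero_obj (im f).
Proof.
move=> f0; apply: zero_obj_idm; apply: (@im_in_mono _ _ _ f).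
by apply: (@im_out_epi _ _ _ f); rewrite compm1 comp0r comp0l im_inK.
Qed.

Lemma tau_geE n M N (g : Hom M N) :
  im_in _ ∘ cmap (tau_ge D H n) g ∘ im_out _ = tau_ge_fun D H n g.
Proof. exact: (image_mapP (tau_ge_funP D H n) (tau_ge_funQ D H n)). Qed.

Lemma tau_leE n M N (g : Hom M N) :
  im_in _ ∘ cmap (tau_le D H n) g ∘ im_out _ = tau_le_fun D H n g.
Proof. exact: (image_mapP (tau_le_funP D H n) (tau_le_funQ D H n)). Qed.

Lemma tau_ge_zero n M :
  (wd_ext (lez_succ n) (D n M) (D (n + 1) M) (idm M)).1 = 0 ->
  zero_obj (tau_ge D H n M).
Proof. by move=> e0; apply: im_zero; rewrite /tau_ge_fun e0 cmap0. Qed.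

Lemma tau_le_zero n M :
  (wd_ext (lez_pred2 n) (D (n - 2) M) (D (n - 1) M) (idm M)).2 = 0 ->
  zero_obj (tau_le D H n M).
Proof. by move=> e0; apply: im_zero; rewrite /tau_le_fun e0 cmap0. Qed.

(** For [X] of weight at least [n + 1] the map [w_{<=n} X -> X] vanishes by orthogonality, hence so
    does the transition map to [w_{<=n+1} X]. *)
Lemma tau_ge_range n : weight_range_le w (tau_ge D H n) n.
Proof.
move=> X gX; apply: tau_ge_zero.
have [E _ _] := wd_extP (lez_succ n) (D n X) (D (n + 1) X) (idm X).
apply: (wl_uniq (wd_le _) (ltz_succ n)); rewrite E comp1m.
exact: w_orthz (wd_le _) gX (ltz_succ n).
Qed.

Lemma tau_le_range n : weight_range_ge w (tau_le D H n) n.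
Proof.
move=> X lX; apply: tau_le_zero.
have [_ E _] := wd_extP (lez_pred2 n) (D (n - 2) X) (D (n - 1) X) (idm X).
apply: (wr_uniq (wd_ge _)); first by rewrite ltrD2r ltz_pred2.
rewrite E compm1; apply: w_orthz lX (wd_ge _) _.
exact: ltz_succ.
Qed.

(** If [m - 1 <= n + 1], the transition map factors through [X], which [H] kills; otherwise
    [w_{<=n} X] itself has weight at most [m - 1]. *)
Lemma tau_ge_range_ge m n :
  weight_range_ge w H m -> weight_range_ge w (tau_ge D H n) m.
Proof.
move=> Hm X lX; apply: im_zero.
rewrite /tau_ge_fun; case: (lerP (m - 1) (n + 1)) => mn.
  have [a Ea] := wl_lift (D (n + 1) X) (idm X) lX mn.
  have [E _ _] := wd_extP (lez_succ n) (D n X) (D (n + 1) X) (idm X).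
  have -> : (wd_ext (lez_succ n) (D n X) (D (n + 1) X) (idm X)).1 = a ∘ wla (D n X).
    apply/eqP; rewrite -subr_eq0; apply/eqP.
    apply: (wl_uniq (wd_le _) (ltz_succ n)).
    by rewrite compBr E compA Ea subrr.
  by have [_ X0] := Hm X lX; rewrite cmapM [cmap H a]X0 comp0r.
have [_ L0] : zero_obj (H (wl (D n X))).
  by apply: Hm; apply: wle_le (wd_le _); lia.
exact: L0.
Qed.

Lemma tau_le_range_le m n :
  weight_range_le w H n -> weight_range_le w (tau_le D H m) n.
Proof.
move=> Hn X gX; apply: im_zero; rewrite /tau_le_fun.
case: (lerP (m - 1) (n + 1)) => mn; last first.
  have [R0 _] : zero_obj (H (wr (D (m - 1) X))).
    by apply: Hn; apply: wge_le (wd_ge _); lia.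
  exact: R0.
have b0 : idm X ∘ wla (D (m - 2) X) = 0 by apply: w_orthz (wd_le _) gX _; lia.
have [b Eb] := dist_desc (wd_dist (D (m - 2) X)) b0.
have [_ E _] := wd_extP (lez_pred2 m) (D (m - 2) X) (D (m - 1) X) (idm X).
have -> : (wd_ext (lez_pred2 m) (D (m - 2) X) (D (m - 1) X) (idm X)).2 =
          wrb (D (m - 1) X) ∘ b.
  apply/eqP; rewrite -subr_eq0; apply/eqP.
  apply: (wr_uniq (wd_ge _)); first by rewrite ltrD2r ltz_pred2.
  by rewrite compBl E -compA Eb subrr.
by have [X0 _] := Hn X gX; rewrite cmapM [cmap H b]X0 comp0l.
Qed.

(** [H M] is itself the image: [H M -> H (w_{<=n+1} M)] is epi because [H] kills [w_{>=n+2} M [-1]],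
    of weight at least [n + 1], and [H M -> H (w_{<=n} M)] is mono. *)
Lemma tau_ge_iso n : cohomological H -> weight_range_le w H n ->
  cofunctor_iso H (tau_ge D H n).
Proof.
move=> cH Hn; pose c M := tau_ge_fun D H n (idm M).
have Ec M N (f : Hom M N) :
    tau_ge_fun D H n f ∘ cmap H (wla (D (n + 1) N)) = cmap H (f ∘ wla (D n M)).
  rewrite -cmapM; congr (cmap H _).
  by have [] := wd_extP (lez_succ n) (D n M) (D (n + 1) N) f.
have Ei M : im_in (c M) ∘ (im_out (c M) ∘ cmap H (wla (D (n + 1) M))) =
            cmap H (wla (D n M)).
  by rewrite compA im_inK Ec comp1m.
exists (fun M => im_out (c M) ∘ cmap H (wla (D (n + 1) M))); split=> [M|M N f].
  apply: mono_epi_iso.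
    by apply: (@mono_cancel _ _ _ _ _ (im_in (c M))); rewrite Ei; exact: weight_range_mono.
  apply: epi_comp; last exact: im_out_epi.
  apply: (cohom_epi_unshift cH (wd_dist _)); apply: Hn.
  exact: wge_unshift (wd_ge _).
apply: (@im_in_mono _ _ _ (c M)).
have := tau_geE n f; rewrite -/(c M) -/(c N) => Ef.
by rewrite !compA Ef Ec -(compA (im_in _)) Ei -cmapM.
Qed.

Lemma tau_le_iso m : cohomological H -> weight_range_ge w H m ->
  cofunctor_iso (tau_le D H m) H.
Proof.
move=> cH Hm; pose c M := tau_le_fun D H m (idm M).
have Ec M N (f : Hom M N) :
    cmap H (wrb (D (m - 2) M)) ∘ tau_le_fun D H m f = cmap H (wrb (D (m - 1) N) ∘ f).
  rewrite -cmapM; congr (cmap H _).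
  by have [] := wd_extP (lez_pred2 m) (D (m - 2) M) (D (m - 1) N) f.
have Ei M : cmap H (wrb (D (m - 2) M)) ∘ im_in (c M) ∘ im_out (c M) =
            cmap H (wrb (D (m - 1) M)).
  by rewrite -compA im_inK Ec compm1.
exists (fun M => cmap H (wrb (D (m - 2) M)) ∘ im_in (c M)); split=> [M|M N f].
  apply: mono_epi_iso.
    apply: mono_comp; first exact: im_in_mono.
    apply: (cohom_mono_shift cH (wd_dist _)); apply: Hm.
    by apply: wle_shift; apply: wle_le (wd_le _); lia.
  by apply: (@epi_cancel _ _ _ _ (im_out (c M))); rewrite Ei; exact: weight_range_epi.
apply: (@im_out_epi _ _ _ (c N)).
have := tau_leE m f; rewrite -/(c M) -/(c N) => Ef.
by rewrite -!compA (compA (im_in _)) Ef Ec (compA (cmap H _) (im_in _)) Ei -cmapM.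
Qed.
End VirtualTruncations.
End Weights.

(** * Commutation of the two truncations *)

Section CommutingTruncations.
Variables (C : tricat) (w : weight_structure C) (D : wd_choice w).
Implicit Types (X Y Z M N : C) (i j k : int).

(* By the octahedron on w_{<=i} w_{<=j} M -> w_{<=j} M -> M, the object
   w_{>=i+1} w_{<=j} M is also a choice of w_{<=j} w_{>=i+1} M, for another
   choice of the i-weight decomposition of M. *)
Record nested_dec i j M := NestedDec {
  nd_dec : wdec w i M;
  nd_in : Hom (wr (D i (wl (D j M)))) (wr nd_dec);
  nd_out : Hom (wr nd_dec) (wr (D j M));
  nd_bd : Hom (wr (D j M)) (shift (wr (D i (wl (D j M)))));
  nd_dist : dist nd_in nd_out nd_bd;
  nd_comm : nd_in ∘ wrb (D i (wl (D j M))) = wrb nd_dec ∘ wla (D j M) }.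

Lemma nested_dec_ex i j M : i < j -> exists d : nested_dec i j M, True.
Proof.
move=> ij; set L := wl (D j M); set a := wla (D i L).
have [Q [q [q' dq]]] := tri_cone (wla (D j M) ∘ a).
have [u [v [duv Eu _ _ _]]] := tri_oct (wd_dist (D i L)) (wd_dist (D j M)) dq.
have gQ : wge w (i + 1) Q.
  apply: (wge_ext D duv (wd_ge _)); apply: (wge_le D) (wd_ge _); lia.
by exists (@NestedDec i j M (WDec dq (wd_le _) gQ) u v _ duv Eu).
Qed.

Lemma nested_wle i j M : i < j -> wle w j (wr (D i (wl (D j M)))).
Proof.
move=> ij; apply: (wle_cone D (wd_dist (D i _)) _ (wd_le _)).
by apply: (wle_le D) (wd_le _); lia.
Qed.

(** Counterpart of [wl_uniq] for the triangle [nd_dist]: the ambiguity of a lift comes from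
    [w_{>=j+1} M [-1]], which is orthogonal to weights below [j]. *)
Lemma nested_uniq k i j M (d : nested_dec i j M) X
    (e : Hom X (wr (D i (wl (D j M))))) :
  wle w k X -> k < j -> nd_in d ∘ e = 0 -> e = 0.
Proof.
move=> lX kj E; apply: shift_faithful; rewrite fmap0.
have Es : (- fmap shift (nd_in d)) ∘ fmap shift e = 0.
  by rewrite compNl -fmapM E fmap0 oppr0.
have [v <-] := dist_lift (dist_rot (dist_rot (nd_dist d))) Es.
by rewrite (w_orthz v (in_shiftS lX) (wd_ge (D j M))) ?comp0r // ltrD2r.
Qed.

Section Commute.
Variables (m n : int).
Hypothesis mn : m <= n.

Let lt0 : m - 2 < n. Proof. lia. Qed.
Let lt1 : m - 1 < n + 1. Proof. lia. Qed.

Let d0 M := sval (cid (nested_dec_ex M lt0)).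
Let d1 M := sval (cid (nested_dec_ex M lt1)).

(** [A0], [A1] are [w_{>=m-1} w_{<=n}] and [w_{>=m} w_{<=n+1}], and [B0], [B1] are the same
    truncations in the other order. The morphisms [alp] and [bet] from level 0 to level 1 will
    present the two composite functors. *)
Let A0 M := wr (D (m - 2) (wl (D n M))).
Let A1 M := wr (D (m - 1) (wl (D (n + 1) M))).
Let B0 M := wl (D n (wr (D (m - 2) M))).
Let B1 M := wl (D (n + 1) (wr (D (m - 1) M))).

Let lam M N (g : Hom M N) := (wd_ext (lez_succ n) (D n M) (D (n + 1) N) g).1.
Let rho M N (g : Hom M N) :=
  (wd_ext (lez_pred2 m) (D (m - 2) M) (D (m - 1) N) g).2.
Let del M N (g : Hom M N) :=
  (wd_ext (lez_pred2 m) (nd_dec (d0 M)) (nd_dec (d1 N)) g).2.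
Let alp M N (g : Hom M N) : Hom (A0 M) (A1 N) :=
  (wd_ext (lez_pred2 m) (D (m - 2) (wl (D n M))) (D (m - 1) (wl (D (n + 1) N)))
     (lam g)).2.
Let bet M N (g : Hom M N) : Hom (B0 M) (B1 N) :=
  (wd_ext (lez_succ n) (D n (wr (D (m - 2) M))) (D (n + 1) (wr (D (m - 1) N)))
     (rho g)).1.

Let r0 M : Hom (A0 M) _ := nd_in (d0 M).
Let r1 M : Hom (A1 M) _ := nd_in (d1 M).
Let s0 M := wla (D n (wr (D (m - 2) M))).
Let s1 M := wla (D (n + 1) (wr (D (m - 1) M))).

Let th0 M := (wd_ext (lexx _) (nd_dec (d0 M)) (D (m - 2) M) (idm M)).2.
Let th0' M := (wd_ext (lexx _) (D (m - 2) M) (nd_dec (d0 M)) (idm M)).2.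
Let th1 M := (wd_ext (lexx _) (nd_dec (d1 M)) (D (m - 1) M) (idm M)).2.
Let th1' M := (wd_ext (lexx _) (D (m - 1) M) (nd_dec (d1 M)) (idm M)).2.

Let lA0 M : wle w n (A0 M). Proof. exact: nested_wle. Qed.
Let lA1 M : wle w (n + 1) (A1 M). Proof. exact: nested_wle. Qed.

Let alpP M N (g : Hom M N) : r1 N ∘ alp g = del g ∘ r0 M.
Proof.
apply/eqP; rewrite -subr_eq0; apply/eqP.
apply: (wr_uniq (wd_ge (nd_dec (d1 N)))); first by rewrite ltrD2r ltz_pred2.
have [_ E _] := wd_extP (lez_pred2 m) (D (m - 2) (wl (D n M)))
  (D (m - 1) (wl (D (n + 1) N))) (lam g).
have [F _ _] := wd_extP (lez_succ n) (D n M) (D (n + 1) N) g.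
have [_ G _] := wd_extP (lez_pred2 m) (nd_dec (d0 M)) (nd_dec (d1 N)) g.
rewrite compBl -!compA E (nd_comm (d0 M)) !compA (nd_comm (d1 N)) G.
by rewrite -!compA F subrr.
Qed.

Let betP M N (g : Hom M N) : s1 N ∘ bet g = rho g ∘ s0 M.
Proof. by have [] := wd_extP (lez_succ n) (D n (wr (D (m - 2) M)))
  (D (n + 1) (wr (D (m - 1) N))) (rho g). Qed.

Let uniqA N X (e e' : Hom X (A1 N)) : wle w n X -> r1 N ∘ e = r1 N ∘ e' -> e = e'.
Proof.
move=> lX E; apply/eqP; rewrite -subr_eq0; apply/eqP.
by apply: (nested_uniq lX (ltz_succ n) (d := d1 N)); rewrite compBr -/(r1 N) E subrr.
Qed.

Let uniqB N X (e e' : Hom X (B1 N)) : wle w n X -> s1 N ∘ e = s1 N ∘ e' -> e = e'.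
Proof.
move=> lX E; apply/eqP; rewrite -subr_eq0; apply/eqP.
by apply: (wl_uniq lX (ltz_succ n)); rewrite compBr -/(s1 N) E subrr.
Qed.

Let p0P M : exists p : Hom (A0 M) (B0 M), s0 M ∘ p = th0 M ∘ r0 M.
Proof. exact: wl_lift (lA0 M) (lexx _). Qed.
Let p1P M : exists p : Hom (A1 M) (B1 M), s1 M ∘ p = th1 M ∘ r1 M.
Proof. exact: wl_lift (lA1 M) (lexx _). Qed.
Let q0P M : exists q : Hom (B0 M) (A0 M), r0 M ∘ q = th0' M ∘ s0 M.
Proof.
apply: (dist_lift (nd_dist (d0 M))).
exact: w_orthz (wd_le _) (wd_ge _) (ltz_succ _).
Qed.
Let q1P M : exists q : Hom (B1 M) (A1 M), r1 M ∘ q = th1' M ∘ s1 M.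
Proof.
apply: (dist_lift (nd_dist (d1 M))).
exact: w_orthz (wd_le _) (wd_ge _) (ltz_succ _).
Qed.

Let p0 M := sval (cid (p0P M)).
Let p1 M := sval (cid (p1P M)).
Let q0 M := sval (cid (q0P M)).
Let q1 M := sval (cid (q1P M)).
Let p0E M : s0 M ∘ p0 M = th0 M ∘ r0 M. Proof. exact: svalP (cid (p0P M)). Qed.
Let p1E M : s1 M ∘ p1 M = th1 M ∘ r1 M. Proof. exact: svalP (cid (p1P M)). Qed.
Let q0E M : r0 M ∘ q0 M = th0' M ∘ s0 M. Proof. exact: svalP (cid (q0P M)). Qed.
Let q1E M : r1 M ∘ q1 M = th1' M ∘ s1 M. Proof. exact: svalP (cid (q1P M)). Qed.

Let compR i j k (ij : i <= j) (jk : j <= k) (ik : i <= k) L M N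
    (d : wdec w i L) (d' : wdec w j M) (d'' : wdec w k N)
    (g : Hom L M) (h : Hom M N) : i < k ->
  (wd_ext jk d' d'' h).2 ∘ (wd_ext ij d d' g).2 = (wd_ext ik d d'' (h ∘ g)).2.
Proof. by move=> lt; rewrite -(wd_ext_comp ij jk ik d d' d''). Qed.

Let rth M N (g : Hom M N) : rho g ∘ th0 M = th1 N ∘ del g.
Proof.
rewrite /rho /th0 /th1 /del !(compR _ _ (lez_pred2 m)) ?ltz_pred2 //.
by rewrite compm1 comp1m.
Qed.

Let dth M N (g : Hom M N) : del g ∘ th0' M = th1' N ∘ rho g.
Proof.
rewrite /rho /th0' /th1' /del !(compR _ _ (lez_pred2 m)) ?ltz_pred2 //.
by rewrite compm1 comp1m.
Qed.

Let dthK M N (g : Hom M N) : del g ∘ th0' M ∘ th0 M = del g.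
Proof. by rewrite /th0' /th0 /del !(compR _ _ (lez_pred2 m)) ?ltz_pred2 ?compm1. Qed.

Let rthK M N (g : Hom M N) : rho g ∘ th0 M ∘ th0' M = rho g.
Proof. by rewrite /th0' /th0 /rho !(compR _ _ (lez_pred2 m)) ?ltz_pred2 ?compm1. Qed.

(** The [p] and [q] are arbitrary lifts, so within one level they need be neither natural nor
    inverse. The relations hold after passage to level 1, since [r1] and [s1] are injective on
    morphisms from objects of weight at most [n] ([uniqA], [uniqB]). *)
Let alp_q M N (g : Hom M N) : alp g ∘ q0 M = q1 N ∘ bet g.
Proof.
apply: uniqA (wd_le _) _.
by rewrite !compA alpP q1E -!compA q0E betP !compA dth.
Qed.

Let bet_p M N (g : Hom M N) : bet g ∘ p0 M = p1 N ∘ alp g.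
Proof.
apply: uniqB (lA0 M) _.
by rewrite !compA betP p1E -!compA p0E alpP !compA rth.
Qed.

Let alp_qp M N (g : Hom M N) : alp g ∘ q0 M ∘ p0 M = alp g.
Proof.
apply: uniqA (lA0 M) _; rewrite !compA alpP -(compA (del g)) q0E -!compA p0E.
by rewrite !compA dthK.
Qed.

Let bet_pq M N (g : Hom M N) : bet g ∘ p0 M ∘ q0 M = bet g.
Proof.
apply: uniqB (wd_le _) _; rewrite !compA betP -(compA (rho g)) p0E -!compA q0E.
by rewrite !compA rthK.
Qed.

(** An iterated truncation is an image of a morphism between images. Composing the two projections
    ([k]) and the two inclusions ([j]) exhibits it as the image of [H] of a single morphism, [alp]
    or [bet], so that [presented_iso] applies. *)
Lemma tau_commute_le (A : abcat) (H : cofunctor C A) :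
  cofunctor_iso (tau_ge D (tau_le D H m) n) (tau_le D (tau_ge D H n) m).
Proof.
pose F := tau_ge D (tau_le D H m) n; pose F' := tau_le D (tau_ge D H n) m.
pose k M : Hom (H (A1 M)) (F M) :=
  im_out (tau_ge_fun D (tau_le D H m) n (idm M)) ∘
  im_out (tau_le_fun D H m (idm (wl (D (n + 1) M)))).
pose j M : Hom (F M) (H (A0 M)) :=
  im_in (tau_le_fun D H m (idm (wl (D n M)))) ∘
  im_in (tau_ge_fun D (tau_le D H m) n (idm M)).
pose k' M : Hom (H (B1 M)) (F' M) :=
  im_out (tau_le_fun D (tau_ge D H n) m (idm M)) ∘
  im_out (tau_ge_fun D H n (idm (wr (D (m - 1) M)))).
pose j' M : Hom (F' M) (H (B0 M)) :=
  im_in (tau_ge_fun D H n (idm (wr (D (m - 2) M)))) ∘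
  im_in (tau_le_fun D (tau_ge D H n) m (idm M)).
have dE M N (g : Hom M N) : j M ∘ cmap F g ∘ k N = cmap H (alp g).
  rewrite /j /k -(compA (im_in (tau_le_fun _ _ _ _))) -compA.
  rewrite (compA (im_in _ ∘ _) (im_out _)) (compA (im_in (tau_le_fun _ _ _ _))).
  by rewrite tau_geE [tau_ge_fun _ _ _ _]/tau_ge_fun tau_leE.
have dE' M N (g : Hom M N) : j' M ∘ cmap F' g ∘ k' N = cmap H (bet g).
  rewrite /j' /k' -(compA (im_in (tau_ge_fun _ _ _ _))) -compA.
  rewrite (compA (im_in _ ∘ _) (im_out _)) (compA (im_in (tau_ge_fun _ _ _ _))).
  by rewrite tau_leE [tau_le_fun _ _ _ _]/tau_le_fun tau_geE.
apply: (presented_iso _ _ _ _ dE dE' (u := fun M => cmap H (q1 M))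
  (u' := fun M => cmap H (p1 M)) (v := fun M => cmap H (q0 M))
  (v' := fun M => cmap H (p0 M))) => [M|M|M|M|M N g|M N g|M|M].
- by apply: epi_comp; exact: im_out_epi.
- by apply: epi_comp; exact: im_out_epi.
- by apply: mono_comp; exact: im_in_mono.
- by apply: mono_comp; exact: im_in_mono.
- by rewrite -!cmapM alp_q.
- by rewrite -!cmapM bet_p.
- by rewrite -!cmapM compA alp_qp.
by rewrite -!cmapM compA bet_pq.
Qed.
End Commute.

Lemma tau_ge_trunc_zero (A : abcat) (H : cofunctor C A) m n : n < m ->
  weight_range_ge w H m -> cofunctor_zero (tau_ge D H n).
Proof.
move=> nm Hm M; have [_ L0] : zero_obj (H (wl (D n M))).
  by apply: Hm; apply: (wle_le D) (wd_le _); lia.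
apply: im_zero; exact: L0.
Qed.

Lemma tau_le_trunc_zero (A : abcat) (H : cofunctor C A) m n : n < m ->
  weight_range_le w H n -> cofunctor_zero (tau_le D H m).
Proof.
move=> nm Hn M; have [R0 _] : zero_obj (H (wr (D (m - 1) M))).
  by apply: Hn; apply: (wge_le D) (wd_ge _); lia.
apply: im_zero; exact: R0.
Qed.

Lemma tau_commute (A : abcat) (H : cofunctor C A) m n :
  cofunctor_iso (tau_ge D (tau_le D H m) n) (tau_le D (tau_ge D H n) m).
Proof.
case: (lerP m n) => [|nm]; first by move=> mn; exact: tau_commute_le.
apply: cofunctor_iso_zero.
  by apply: (tau_ge_trunc_zero nm); exact: tau_le_range.
by apply: (tau_le_trunc_zero nm); exact: tau_ge_range.
Qed.
End CommutingTruncations.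

(** * Weight complexes of a triangle *)

Section WeightComplexTriangles.
Variables (C : tricat) (w : weight_structure C) (D : wd_choice w).
Variable E : wcone_choice D.
Implicit Types (X Y Z M N T : C) (i : int).

Let win i M := (wd_ext (lez_pred i) (D (i - 1) M) (D i M) (idm M)).1.

Lemma gr_in_win i M : gr_in (E i M) ∘ win i M = 0.
Proof. exact: dist_comp0 (gr_dist (E i M)). Qed.

(* The octahedron on w_{<=i-1} M -> w_{<=i} M -> M. *)
Record gr_to_wr i M := GrToWr {
  gw_map : Hom (gr (E i M)) (wr (D (i - 1) M));
  gw_out : Hom (wr (D (i - 1) M)) (wr (D i M));
  gw_bd : Hom (wr (D i M)) (shift (gr (E i M)));
  gw_dist : dist gw_map gw_out gw_bd;
  gw_in : gw_map ∘ gr_in (E i M) = wrb (D (i - 1) M) ∘ wla (D i M);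
  gw_wdc : wdc (D (i - 1) M) ∘ gw_map = gr_out (E i M) }.

Lemma gr_to_wr_ex i M : exists r : gr_to_wr i M, True.
Proof.
have d := wd_dist (D (i - 1) M); rewrite -[wla _](w_inK D i M) in d.
have [u [v [duv E1 E2 _ _]]] := tri_oct (gr_dist (E i M)) (wd_dist (D i M)) d.
by exists (@GrToWr i M u v _ duv E1 E2).
Qed.

Lemma gr_to_wr_lift i M (r : gr_to_wr i M) T (c : Hom T (wr (D (i - 1) M))) :
  wle w i T -> exists u : Hom T (gr (E i M)), gw_map r ∘ u = c.
Proof.
by move=> lT; apply: (dist_lift (gw_dist r)); exact: w_orthz lT (wd_ge _) (ltz_succ i).
Qed.

(** The boundary of [u] vanishes, so [u] lifts to [w_{<=i} M]. Subtracting a morphism through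
    [w_{<=i-1} M] makes the lift vanish in [M] without changing its image in [gr_i]. *)
Lemma gr_to_wr_ker i M (r : gr_to_wr i M) T (u : Hom T (gr (E i M))) :
  gw_map r ∘ u = 0 ->
  exists s : Hom T (wl (D i M)), gr_in (E i M) ∘ s = u /\ wla (D i M) ∘ s = 0.
Proof.
move=> ru.
have ou : gr_out (E i M) ∘ u = 0 by rewrite -(gw_wdc r) -compA ru comp0r.
have [s Es] := dist_lift (dist_rot (gr_dist (E i M))) ou.
have bs : wrb (D (i - 1) M) ∘ (wla (D i M) ∘ s) = 0.
  by rewrite compA -(gw_in r) -compA Es.
have [t Et] := dist_lift (wd_dist (D (i - 1) M)) bs.
exists (s - win i M ∘ t); split.
  by rewrite compBr Es compA gr_in_win comp0l subr0.
by rewrite compBr compA w_inK Et subrr.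
Qed.

Lemma gr_in_desc i M T (u : Hom (wl (D i M)) T) :
  wge w i T -> exists v : Hom (gr (E i M)) T, v ∘ gr_in (E i M) = u.
Proof.
move=> gT; apply: (dist_desc (gr_dist (E i M))).
exact: w_orthz (wd_le _) gT (ltz_pred i).
Qed.

(** Source of the [k d] terms of weak homotopies: [u] descends to [w_{<=i-1} M [1]], then to
    [gr_{i-1} [1]], because [w_{<=i-2} M [1]] has weight below [i]. *)
Lemma gr_bd_desc i M T (u : Hom (gr (E i M)) T) : wge w i T ->
  u ∘ gr_in (E i M) = 0 ->
  exists v : Hom (shift (gr (E (i - 1) M))) T, v ∘ gr_bd E i M = u.
Proof.
move=> gT u0; have [v Ev] := dist_desc (dist_rot (gr_dist (E i M))) u0.
have v0 : v ∘ fmap shift (win (i - 1) M) = 0.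
  apply: w_orthz (in_shiftS (wd_le _)) gT _.
  by rewrite subrK ltz_pred.
have [t Et] := dist_desc (dist_shift (gr_dist (E (i - 1) M))) v0.
by exists t; rewrite /gr_bd compA Et.
Qed.

(** First half of the differential [M^{-1} -> M^0]; following it by [gr_in] gives [gr_unbd0], which
    [wcx_dm1E] identifies with [wcx_dm1]. *)
Definition gr_unbd M : Hom (unshift (gr (E 1 M))) (wl (D 0 M)) :=
  unit_inv (wl (D 0 M)) ∘ fmap unshift (gr_out (E 1 M)).

Lemma wla_gr_unbd M : wla (D 0 M) ∘ gr_unbd M = 0.
Proof.
have [g' d] := dist_unrot (gr_dist (E 1 M)).
by rewrite -[wla (D 0 M)](w_inK D 1 M) -compA [_ ∘ gr_unbd M](dist_comp0 d) comp0r.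
Qed.

Lemma gr_unbd_lift M T (s : Hom T (wl (D 0 M))) : wle w 0 T ->
  wla (D 0 M) ∘ s = 0 -> exists t, gr_unbd M ∘ t = s.
Proof.
move=> lT as0; have [g' d] := dist_unrot (gr_dist (E 1 M)).
apply: (dist_lift d); apply: (wl_uniq lT ltr01).
by rewrite compA w_inK.
Qed.

Definition gr_unbd0 M : Hom (unshift (gr (E 1 M))) (gr (E 0 M)) :=
  gr_in (E 0 M) ∘ gr_unbd M.

Lemma wcx_dm1E M : wcx_dm1 E M = gr_unbd0 M.
Proof.
pose o : Hom (gr (E 1 M)) (shift (wl (D 0 M))) := gr_out (E 1 M).
transitivity (unit_inv (gr (E 0 M)) ∘
    (fmap unshift (fmap shift (gr_in (E 0 M))) ∘ fmap unshift o)).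
  exact: (congr1 (comp (unit_inv (gr (E 0 M))))
    (fmapM unshift (fmap shift (gr_in (E 0 M))) o)).
by rewrite compA unit_inv_nat -compA.
Qed.

Lemma gr_to_wr_ker0 M (r : gr_to_wr 0 M) T (u : Hom T (gr (E 0 M))) :
  wle w 0 T -> gw_map r ∘ u = 0 -> exists s, u = gr_unbd0 M ∘ s.
Proof.
move=> lT /gr_to_wr_ker[s [<- /(gr_unbd_lift lT)[t <-]]].
by exists t; rewrite compA.
Qed.

(* N plays the role of w_{<=0} Z and (e1, e2) : N -> gr_0 Y (+) gr_{-1} X [1]
   that of the projection to the degree 0 term of the cone of f on weight
   complexes.  P is the cone of w_{<=-1} X -> Y. *)
Lemma wcone_dist X Y Z (f : Hom X Y) (g : Hom Y Z) h : dist f g h ->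
  exists N (z : Hom N Z) (i : Hom (wl (D 0 Y)) N) (e1 : Hom N (gr (E 0 Y)))
    (e2 : Hom N (shift (gr (E (0 - 1) X)))) (f0 : Hom (gr (E 0 X)) (gr (E 0 Y))),
  [/\ gr_mor f f0, z ∘ i = g ∘ wla (D 0 Y),
      (exists s, e1 ∘ i = gr_in (E 0 Y) + gr_unbd0 Y ∘ s) /\ e2 ∘ i = 0,
      forall T (c : Hom T Z), wle w 0 T -> exists c', z ∘ c' = c
    & forall T (c : Hom T N), wle w 0 T -> z ∘ c = 0 -> exists t s,
        e1 ∘ c = f0 ∘ t + gr_unbd0 Y ∘ s /\ e2 ∘ c = gr_bd E 0 X ∘ t].
Proof.
move=> d; have [b Eb] := wla_lift D (0 - 1) f.
have [N [i [del dN]]] := tri_cone (win 0 Y ∘ b).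
have [P [iP [delP dP]]] := tri_cone (f ∘ wla (D (0 - 1) X)).
have EP : wla (D 0 Y) ∘ (win 0 Y ∘ b) = f ∘ wla (D (0 - 1) X).
  by rewrite compA w_inK.
have dP' := dP; rewrite -EP in dP'.
(* [N -> P] has cone [w_{>=1} Y], and [P -> Z] will have cone [w_{>=0} X [1]]. Both are orthogonal
   to weights at most 0, so morphisms from such objects to [Z] lift to [N]. *)
have [nu [v1 [dnu nui delnu _ _]]] := tri_oct dN (wd_dist (D 0 Y)) dP'.
have [mu [ze [dmu mub delmu zei _]]] := tri_oct (wd_dist (D (0 - 1) X)) d dP.
have [pi [pii pib]] := tri_mor dP (wd_dist (D (0 - 1) Y)) (a := b) (b := idm Y)
  (etrans (comp1m _) (esym Eb)).
rewrite compm1 in pii.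
have [rX _] := gr_to_wr_ex 0 X; have [rY _] := gr_to_wr_ex 0 Y.
have lN : wle w 0 N by exact: (wle_cone D dN (wd_le _) (wd_le _)).
have [e1 Ee1] := gr_to_wr_lift rY (pi ∘ nu) lN.
have [f0 Ef0] := gr_to_wr_lift rY (pi ∘ mu ∘ gw_map rX) (gr_weq E 0 X).1.
exists N, (ze ∘ nu), i, e1, (fmap shift (gr_in (E (0 - 1) X)) ∘ del), f0; split.
(* [f0] was built on [w_{>=0}]. Its component [a'] on [w_{<=0}] is recovered from the triangle of
   [gr_0 Y], then corrected through [w_{<=-1} Y] so as to lie over [f]. *)
- have Eo : fmap shift b ∘ gr_out (E 0 X) = gr_out (E 0 Y) ∘ f0.
    rewrite -(gw_wdc rY) -compA Ef0 !compA -pib -(compA _ delP) delmu.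
    by rewrite -compA gw_wdc.
  have o0 : gr_out (E 0 Y) ∘ (f0 ∘ gr_in (E 0 X)) = 0.
    by rewrite compA -Eo -compA gr_out_in comp0r.
  have [a' Ea'] := dist_lift (dist_rot (gr_dist (E 0 Y))) o0.
  have b0 : wrb (D (0 - 1) Y) ∘ (wla (D 0 Y) ∘ a' - f ∘ wla (D 0 X)) = 0.
    rewrite compBr (compA _ _ a') -(gw_in rY) -(compA _ _ a') Ea' compA Ef0.
    rewrite -(compA _ (gw_map rX)) gw_in (compA _ _ (wla (D 0 X))) -(compA pi mu).
    by rewrite mub (compA pi) pii (compA _ f) subrr.
  have [t Et] := dist_lift (wd_dist (D (0 - 1) Y)) b0.
  exists (a' - win 0 Y ∘ t), b; split=> //.
    by rewrite compBr compA w_inK Et opprB addrC subrK.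
  by rewrite compBr Ea' compA gr_in_win comp0l subr0.
- by rewrite -compA nui compA zei.
- split; last by rewrite -compA (dist_comp0 (dist_rot dN)) comp0r.
  have [|s Es] := @gr_to_wr_ker0 Y rY _ (e1 ∘ i - gr_in (E 0 Y)) (wd_le _).
    by rewrite compBr compA Ee1 gw_in -compA nui compA pii subrr.
  by exists s; rewrite -Es addrC subrK.
- move=> T c lT.
  have gR := in_shiftS (wd_ge (D (0 - 1) X)).
  have [c1 Ec1] := dist_lift (dist_rot dmu) (w_orthz (_ ∘ c) lT gR isT).
  have [c2 Ec2] := dist_lift dnu (w_orthz (v1 ∘ c1) lT (wd_ge (D 0 Y)) isT).
  by exists c2; rewrite -compA Ec2.
move=> T c lT; rewrite -compA => /(dist_lift dmu)[t0 Et0].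
have [t Et] := gr_to_wr_lift rX t0 lT.
have [|s Es] := @gr_to_wr_ker0 Y rY _ (e1 ∘ c - f0 ∘ t) lT.
  by rewrite compBr !compA Ee1 Ef0 -!compA Et Et0 subrr.
exists t, s; split; first by rewrite -Es addrC subrK.
rewrite /gr_bd -!compA; congr (_ ∘ _).
by rewrite -delnu -compA -Et0 compA delmu -Et compA gw_wdc.
Qed.

(** [(a, b)] is the degree 0 part of a map from the complex of [Z] to the cone of [f], whose term is
    [Y^0 (+) X^1]. The third clause says that boundaries go to boundaries, the fourth that the
    composite with [g0] is the inclusion of [Y^0] up to weak homotopy. *)
Lemma wcx_dist X Y Z (f : Hom X Y) (g : Hom Y Z) h : dist f g h ->
  exists (f0 : Hom (wcx E 0 X) (wcx E 0 Y)) (g0 : Hom (wcx E 0 Y) (wcx E 0 Z))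
    (a : Hom (wcx E 0 Z) (wcx E 0 Y)) (b : Hom (wcx E 0 Z) (wcx E 1 X)),
  [/\ gr_mor (i := 0) f f0, gr_mor (i := 0) g g0,
      exists (t : Hom (wcx E (-1) Z) (wcx E 0 X))
             (s : Hom (wcx E (-1) Z) (wcx E (-1) Y)),
        a ∘ wcx_dm1 E Z = f0 ∘ t + wcx_dm1 E Y ∘ s /\
        b ∘ wcx_dm1 E Z = wcx_d0 E X ∘ t
    & exists (t : Hom (wcx E 0 Y) (wcx E 0 X)) (s : Hom (wcx E 0 Y) (wcx E (-1) Y))
             (k : Hom (wcx E 1 Y) (wcx E 0 Y)) (l : Hom (wcx E 1 Y) (wcx E 1 X)),
        a ∘ g0 = idm _ + wcx_dm1 E Y ∘ s + f0 ∘ t + k ∘ wcx_d0 E Y /\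
        b ∘ g0 = wcx_d0 E X ∘ t + l ∘ wcx_d0 E Y].
Proof.
move=> d; have [N [z [i [e1 [e2 [f0 [mf zi [[s0 e1i] e2i] lift ker]]]]]]] := wcone_dist d.
have [g0 mg] := gr_mor_ex E 0 g; have [g1 [_ [Eg1 _ Eg0 _]]] := mg.
have [phi Ephi] := lift _ (wla (D 0 Z)) (wd_le _).
have g0W M := (gr_weq E 0 M).2.
have g1W : wge w 0 (shift (gr (E (0 - 1) X))) := in_shiftS (gr_weq E (0 - 1) X).2.
have gmW M : weq w 0 (unshift (gr (E 1 M))) by exact: wcx_weq E (-1) M.
have [a Ea] := gr_in_desc (e1 ∘ phi) (g0W Y).
have [b Eb] := gr_in_desc (e2 ∘ phi) g1W.
(* Both systems of relations come from [ker], applied to two morphisms into [N] that vanish in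
   [Z]. *)
have [|t1 [s1 [E11 E12]]] := ker _ (phi ∘ gr_unbd Z) (gmW Z).1.
  by rewrite compA Ephi wla_gr_unbd.
have [|t2 [s2 [E21 E22]]] := ker _ (phi ∘ g1 - i) (wd_le _).
  by rewrite compBr compA Ephi Eg1 zi subrr.
have [t Et] := gr_in_desc t2 (g0W X).
have [s Es] := gr_in_desc (s0 + s2) (gmW Y).2.
have Es' : gr_unbd0 Y ∘ s ∘ gr_in (E 0 Y) = gr_unbd0 Y ∘ s0 + gr_unbd0 Y ∘ s2.
  by rewrite -compDr -Es; exact/esym/compA.
have Ec T (c : Hom N T) (c' : Hom (gr (E 0 Z)) T) : c' ∘ gr_in (E 0 Z) = c ∘ phi ->
    c' ∘ g0 ∘ gr_in (E 0 Y) = c ∘ (phi ∘ g1 - i) + c ∘ i.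
  by move=> E'; rewrite -compA Eg0 compA E' -compA -compDr subrK.
have [|k Ek] := gr_bd_desc (u := a ∘ g0 - (idm _ + gr_unbd0 Y ∘ s + f0 ∘ t)) (g0W Y).
  rewrite compBl (Ec _ _ _ Ea) !compDl Es' -(compA f0) Et comp1m E21 e1i.
  apply/eqP; rewrite subr_eq0; apply/eqP.
  by rewrite addrC -!addrA; congr (_ + (_ + _)); rewrite addrC.
have [|l El] := gr_bd_desc (u := b ∘ g0 - gr_bd E 0 X ∘ t) g1W.
  by rewrite compBl (Ec _ _ _ Eb) -compA Et E22 e2i addr0 subrr.
exists f0, g0, a, b; split=> //.
  exists t1, s1; rewrite !wcx_dm1E; split.
    by transitivity (a ∘ gr_unbd0 Z) => //; rewrite /gr_unbd0 compA Ea -compA E11.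
  by transitivity (b ∘ gr_unbd0 Z) => //; rewrite /gr_unbd0 compA Eb -compA E12.
exists t, s, k, l; rewrite !wcx_dm1E; split.
  transitivity (a ∘ g0 : Hom (gr (E 0 Y)) (gr (E 0 Y))) => //.
  by rewrite -[LHS](subrK (idm _ + gr_unbd0 Y ∘ s + f0 ∘ t)) -Ek addrC.
transitivity (b ∘ g0 : Hom (gr (E 0 Y)) _) => //.
by rewrite -[LHS](subrK (gr_bd E 0 X ∘ t)) -El addrC.
Qed.
End WeightComplexTriangles.

(** * Pure functors *)

Section PureFunctorTheory.
Variables (C : tricat) (w : weight_structure C) (D : wd_choice w).
Variable E : wcone_choice D.
Variable A : abcat.
Implicit Types (X Y Z M N T : C) (i : int).

Section Pure.
Variable F : cofunctor (heart w) A.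

Lemma pure_map_ind M N (g : Hom M N) (f : Hom (wcx E 0 M) (wcx E 0 N)) :
  gr_mor (i := 0) g f -> pure_ind (F := F) f (pure_map E F g).
Proof.
move=> fP; have [f1 Ef1] := gr_mor_d0 (f := f) fP; have [f2 Ef2] := gr_mor_dm1 (f := f) fP.
have Ex : cmap F (wcx_d0 E M) ∘ cmap F f1 = cmap F f ∘ cmap F (wcx_d0 E N).
  by rewrite -!cmapM Ef1.
have Ez : cmap F f2 ∘ cmap F (wcx_dm1 E N) = cmap F (wcx_dm1 E M) ∘ cmap F f.
  by rewrite -!cmapM Ef2.
have [t tP] := homology_ind_ex (pure_cplx E F N) (pure_cplx E F M) Ex Ez.
by rewrite -(pure_map_uniq fP tP).
Qed.

(* The sequence is that of the long exact sequence of a mapping cone: a cocycle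
   y at Y with f0^* y = d^* x lifts to the cocycle (y, x) of the cone. *)
Lemma pure_cohomological : cohomological (pure_functor E F).
Proof.
move=> X Y Z f g h d; apply: exact_atP; first by rewrite -cmapM (dist_comp0 d) cmap0.
move=> W u fu0; have [f0 [g0 [a [b [mf mg]]]]] := wcx_dist E d.
move=> [t1 [s1 [E11 E12]]] [t [s [k [l [E21 E22]]]]].
have [W1 [e1 [y1 [ee1 ry1]]]] := represents_cover u.
have := represents_ind (pure_map_ind mf) ry1; rewrite compA.
have -> : pure_map E F f ∘ u = 0 by exact: fu0.
rewrite comp0l => /represents0[W2 [e2 [x [ee2 Ex]]]].
have ry := represents_comp e2 ry1; rewrite -compA in Ex; move: (y1 ∘ e2) ry Ex => y ry Ex.
have dy := represents_cycle ry.
have [|v rv] := @represents_ex _ _ _ _ _ _ (pure_cplx E F Z) _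
  (cmap F a ∘ y - cmap F b ∘ x).
  rewrite compBr !compA -!cmapM E11 E12 cmapD !cmapM compDl -!compA dy comp0r.
  by rewrite addr0 Ex subrr.
exists W2, (e1 ∘ e2), v; split; first exact: epi_comp.
have := representsB (represents_ind (pure_map_ind mg) rv) ry.
have -> : cmap F g0 ∘ (cmap F a ∘ y - cmap F b ∘ x) - y =
          cmap F (wcx_d0 E Y) ∘ (cmap F k ∘ y - cmap F l ∘ x).
  rewrite !compBr !compA -!cmapM E21 E22 !cmapD cmap1 !cmapM !compDl comp1m.
  rewrite -!compA dy comp0r addr0 Ex.
  by rewrite opprD addrC !addrA addNr add0r (addrC (cmap F t ∘ _)) addrK.
move=> /represents_uniq/(_ (represents_boundary _ _))/eqP.
by rewrite subr_eq0 compA => /eqP.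
Qed.

Lemma pure_map_zero M : pure_map E F (idm M) = 0 -> zero_obj (pure_functor E F M).
Proof.
by move=> h; apply: zero_obj_idm; rewrite -[RHS]h; exact/esym/pure_map1.
Qed.

(** Any component over a morphism computes its action. In weight at most -1, [idm M] factors through
    [w_{<=-1} M], so [0] on [gr_0] lies over [idm M]; in weight at least 1, [w_{<=i} M -> M]
    vanishes for [i <= 0], so the identity of [gr_0] lies over [0]. *)
Lemma pure_range : weight_range w (pure_functor E F) 0 0.
Proof.
split=> M wM; apply: pure_map_zero.
  have b0 : wrb (D (0 - 1) M) ∘ idm M = 0 by exact: w_orthz wM (wd_ge _) (ltz_succ _).
  have [s Es] := dist_lift (wd_dist (D (0 - 1) M)) b0.
  pose win := (wd_ext (lez_pred 0) (D (0 - 1) M) (D 0 M) (idm M)).1.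
  have m0 : gr_mor (E := E) (i := 0) (idm M) 0.
    exists (win ∘ s ∘ wla (D 0 M)), (s ∘ wla (D (0 - 1) M)); split.
    - by rewrite !compA w_inK Es.
    - by rewrite compA Es.
    - by rewrite comp0l !compA (dist_comp0 (gr_dist (E 0 M))) !comp0l.
    rewrite comp0r -(w_inK D 0 M) !fmapM -!compA.
    have := dist_comp0 (dist_rot (dist_rot (gr_dist (E 0 M)))).
    by rewrite compNl => /eqP; rewrite oppr_eq0 => /eqP ->; rewrite !comp0r.
  apply/esym/(@pure_map_uniq _ _ _ _ _ _ _ _ _ (0 : Hom (wcx E 0 M) (wcx E 0 M))).
    exact: m0.
  by exists 0; rewrite cmap0 !comp0l !comp0r.
have a0 i : i <= 0 -> wla (D i M) = 0.
  by move=> i0; apply: w_orthz (wd_le _) wM _; lia.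
have m0 : gr_mor (E := E) (i := 0) (0 : Hom M M) (idm (gr (E 0 M))).
  by exists (idm _), (idm _); rewrite !a0 // ?fmap1 !comp0l !comp1m !compm1.
have m1 : pure_map E F (0 : Hom M M) = 0 by exact: (cmap0 (pure_functor E F)).
rewrite -[RHS]m1; apply: (@pure_map_uniq _ _ _ _ _ _ _ _ _ (idm (wcx E 0 M))).
  exact: m0.
by rewrite pure_map1 /pure_ind cmap1; exact: homology_ind1.
Qed.
End Pure.

Definition heart_incl : functor (heart w) C :=
  @Functor (heart w) C (fun U => sval U) (fun _ _ f => f)
    (fun _ => erefl) (fun _ _ _ _ _ => erefl) (fun _ _ _ _ => erefl).

(** * Recovery of a functor of range [[0,0]] from its restriction to the heart *)

Section Recognition.
Variable K : cofunctor C A.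
Hypotheses (cK : cohomological K) (rK : weight_range w K 0 0).
Let F := ccomp K heart_incl.

Let kle i X : i < 0 -> wle w i X -> zero_obj (K X).
Proof. by move=> i0 lX; apply: rK.1; apply: (wle_le D) lX; lia. Qed.
Let kge i X : 0 < i -> wge w i X -> zero_obj (K X).
Proof. by move=> i0 gX; apply: rK.2; apply: (wge_le D) gX; lia. Qed.

Let g_in M : Hom (K (gr (E 0 M))) (K (wl (D 0 M))) := cmap K (gr_in (E 0 M)).
Let dm M : Hom (K (gr (E 0 M))) (K (unshift (gr (E 1 M)))) := cmap K (gr_unbd0 E M).
Let d0 M : Hom (K (shift (gr (E (0 - 1) M)))) (K (gr (E 0 M))) := cmap K (gr_bd E 0 M).

Let wla_mono M : mono (cmap K (wla (D 0 M))).
Proof. by apply: (cohom_mono cK (wd_dist _)); exact: kge (ltz_succ _) (wd_ge _). Qed.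

Let g_in_epi M : epi (g_in M).
Proof. by apply: (cohom_epi cK (gr_dist _)); exact: kle (ltz_pred _) (wd_le _). Qed.

(** Exactness gives a preimage in [K (w_{<=-1} M [1])], which [K (gr_{-1} [1])] covers because [K]
    kills [w_{<=-2} M [1]], of weight at most -1. *)
Let g_in_ker M W (y : Hom W (K (gr (E 0 M)))) : g_in M ∘ y = 0 ->
  exists W' (e : Hom W' W) x, epi e /\ d0 M ∘ x = y ∘ e.
Proof.
move=> y0.
have [W1 [e1 [x1 [ee1 Ex1]]]] := exact_lift (cK (dist_rot (gr_dist (E 0 M)))) y0.
have ek : epi (cmap K (fmap shift (gr_in (E (0 - 1) M)))).
  apply: (cohom_epi cK (dist_shift (gr_dist (E (0 - 1) M)))).
  by apply: kle (in_shiftS (wd_le _)).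
have [W2 [e2 [x2 [ee2 Ex2]]]] := epi_pullback x1 ek.
exists W2, (e1 ∘ e2), x2; split; first exact: epi_comp.
by rewrite /d0 cmapM -compA Ex2 !compA Ex1.
Qed.

Let wla_lift_ker M W (v : Hom W (K (wl (D 0 M)))) : cmap K (gr_unbd E M) ∘ v = 0 ->
  exists W' (e : Hom W' W) x, epi e /\ cmap K (wla (D 0 M)) ∘ x = v ∘ e.
Proof.
move=> v0; have [g' d] := dist_unrot (gr_dist (E 1 M)).
have [W1 [e1 [x1 [ee1 Ex1]]]] := exact_lift (cK d) v0.
have ek : epi (cmap K (wla (D 1 M))).
  apply: (cohom_epi_unshift cK (wd_dist _)); apply: (@kge 1) => //.
  exact: wge_unshift (wd_ge _).
have [W2 [e2 [x2 [ee2 Ex2]]]] := epi_pullback x1 ek.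
exists W2, (e1 ∘ e2), x2; split; first exact: epi_comp.
by rewrite -(w_inK D 1 M) cmapM -compA Ex2 !compA Ex1.
Qed.

Let cplx M := pure_cplx E F M.

Let dmE M : cmap F (wcx_dm1 E M) = dm M.
Proof. by rewrite wcx_dm1E. Qed.

Let dm_g_in M : cmap K (gr_unbd E M) ∘ g_in M = cmap F (wcx_dm1 E M).
Proof. by rewrite dmE /g_in -cmapM. Qed.

Let kin M : Hom (ker (cmap F (wcx_dm1 E M))) (K (gr (E 0 M))) :=
  ker_in (cmap F (wcx_dm1 E M)).

(** This determines [t], since [cmap K (wla (D 0 M))] is mono and [homology_out] is epi; naturality
    in [M] is deduced from it. *)
Let res_spec M (t : Hom (pure_obj E F M) (K M)) : Prop :=
  cmap K (wla (D 0 M)) ∘ (t ∘ homology_out (cplx M)) = g_in M ∘ kin M.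

Lemma pure_res_ex M : exists t : Hom (pure_obj E F M) (K M), is_iso t /\ res_spec t.
Proof.
have gk0 : cmap K (gr_unbd E M) ∘ (g_in M ∘ kin M) = 0.
  by rewrite compA dm_g_in; have [] := ker_inP (cmap F (wcx_dm1 E M)).
have [W1 [e1 [x1 [ee1 Ex1]]]] := wla_lift_ker gk0.
have [th [Eth _]] := mono_fill (@wla_mono M) ee1 Ex1.
have g_in_d0 : g_in M ∘ d0 M = 0.
  by rewrite /g_in /d0 -cmapM /gr_bd -compA gr_out_in comp0r cmap0.
have th0 : th ∘ ker_lift (cplx M) = 0.
  apply: (mono_eq0 (@wla_mono M)); rewrite compA Eth -compA.
  have -> : kin M ∘ ker_lift (cplx M) = d0 M by exact: ker_liftK.
  exact: g_in_d0.
have [t [Et _]] := (coker_outP (ker_lift (cplx M))).2 _ _ th0.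
have Et' : t ∘ homology_out (cplx M) = th by exact: Et.
exists t; split; last by rewrite /res_spec Et'.
apply: mono_epi_iso.
  apply: mono0 => W u tu0.
  have [W2 [e2 [y [ee2 ry]]]] := represents_cover u.
  have [l [El Eu]] := ry.
  have gy0 : g_in M ∘ y = 0.
    by rewrite -El compA -Eth -Et' -!compA Eu (compA t) tu0 comp0l comp0r.
  have [W3 [e3 [x [ee3 Ex]]]] := g_in_ker gy0.
  apply: (epi_eq0 (epi_comp ee3 ee2)).
  have := represents_comp e3 ry; rewrite -Ex compA => /represents_uniq.
  by apply; exact: (represents_boundary (cplx M) x).
apply: epi0 => W v vt.
have [W2 [e2 [y [ee2 Ey]]]] := epi_pullback (cmap K (wla (D 0 M))) (@g_in_epi M).
have dy : cmap F (wcx_dm1 E M) ∘ y = 0.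
  by rewrite -dm_g_in -compA Ey compA -cmapM wla_gr_unbd cmap0 comp0l.
have [l [El _]] := (ker_inP (cmap F (wcx_dm1 E M))).2 _ _ dy.
have tl : th ∘ l = e2.
  apply: (@wla_mono M); rewrite compA Eth -Ey -compA; congr (_ ∘ _); exact: El.
by apply: (epi_eq0 ee2); rewrite -tl -Et' !compA vt !comp0l.
Qed.

Lemma pure_res_iso : cofunctor_iso (pure_functor E F) K.
Proof.
exists (fun M => sval (cid (pure_res_ex M))); split=> [M|M N g].
  by case: (svalP (cid (pure_res_ex M))).
case: (cid _) => t [ti ts]; case: (cid _) => t' [ti' ts'] /=.
have [f mf] := gr_mor_ex E 0 g; have [a [_ [Ea _ Ef _]]] := mf.
have [k [Ek Ek']] := pure_map_ind F (f := f) mf.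
apply: (cokernel_epi (coker_outP _)); apply: (@wla_mono M).
rewrite -[coker_out _]/(homology_out (cplx N)).
have Ek2 : kin M ∘ k = cmap K f ∘ kin N by exact: Ek.
transitivity (g_in M ∘ kin M ∘ k).
  by rewrite -ts -!compA; congr (_ ∘ (_ ∘ _)); exact: Ek'.
rewrite -compA Ek2 compA /g_in -cmapM Ef cmapM -compA -/(g_in N) -ts'.
by rewrite !compA -!cmapM Ea.
Qed.
End Recognition.
End PureFunctorTheory.

(** * Powers of the shift *)

Lemma is_iso_comp (C : precat) (X Y Z : C) (f : Hom X Y) (g : Hom Y Z) :
  is_iso f -> is_iso g -> is_iso (g ∘ f).
Proof.
move=> [f' [f'f ff']] [g' [g'g gg']]; exists (f' ∘ g').
by rewrite -!compA (compA g') g'g comp1m f'f (compA f) ff' comp1m gg'.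
Qed.

Section NatIso.
Variables C D : precat.

Lemma is_iso_fmap (F : functor C D) X Y (f : Hom X Y) :
  is_iso f -> is_iso (fmap F f).
Proof. by move=> [g [gf fg]]; exists (fmap F g); rewrite -!fmapM gf fg !fmap1. Qed.

Lemma nat_iso_sym (F G : functor C D) : nat_iso F G -> nat_iso G F.
Proof.
move=> a; pose b X := sval (cid (ni_iso a X)).
have ba X : b X ∘ a X = idm _ by case: (svalP (cid (ni_iso a X))).
have ab X : a X ∘ b X = idm _ by case: (svalP (cid (ni_iso a X))).
apply: (@NatIso _ _ _ _ b) => [X|X Y f]; first by exists (a X).
apply: (is_iso_mono (ni_iso a Y)).
by rewrite !compA ab comp1m (ni_nat a) -compA ab compm1.
Qed.

Lemma nat_iso_trans (F G H : functor C D) : nat_iso F G -> nat_iso G H -> nat_iso F H.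
Proof.
move=> a b; apply: (@NatIso _ _ _ _ (fun X => b X ∘ a X)) => [X|X Y f].
  exact: is_iso_comp (ni_iso a X) (ni_iso b X).
by rewrite -compA (ni_nat a) compA (ni_nat b) compA.
Qed.
End NatIso.

Section Iterates.
Variable C : precat.

Lemma fiter_comm (F : functor C C) k :
  nat_iso (fcomp (fiter k F) F) (fcomp F (fiter k F)).
Proof.
elim: k => [|k a].
  apply: (@NatIso _ _ (fcomp (fiter 0 F) F) (fcomp F (fiter 0 F))
    (fun X => idm (F X))) => [X|X Y f].
    by exists (idm (F X)); rewrite !comp1m.
  by rewrite comp1m compm1.
apply: (@NatIso _ _ (fcomp (fiter k.+1 F) F) (fcomp F (fiter k.+1 F))
  (fun X => fmap F (a X))) => [X|X Y f].
  exact: (is_iso_fmap F (ni_iso a X)).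
by have := congr1 (fmap F) (ni_nat a f); rewrite !fmapM.
Qed.

(** [fiter] adds factors on the outside, so in [F (F^k (G (G^k X)))] the block [F^k] separates [F]
    from [G]; [fiter_comm] moves [F] past it. *)
Lemma fiter_inv (F G : functor C C) k :
  nat_iso (fid C) (fcomp F G) -> nat_iso (fid C) (fcomp (fiter k F) (fiter k G)).
Proof.
move=> e; elim: k => [|k a].
  apply: (@NatIso _ _ (fid C) (fcomp (fid C) (fid C)) (fun X => idm X)) => [X|X Y f].
    by exists (idm X); rewrite !comp1m.
  by rewrite comp1m compm1.
apply: (nat_iso_trans a).
apply: (@NatIso _ _ (fcomp (fiter k F) (fiter k G)) (fcomp (fiter k.+1 F) (fiter k.+1 G))
  (fun X => ni_map (fiter_comm F k) (G (fiter k G X)) ∘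
   fmap (fiter k F) (e (fiter k G X)))) => [X|X Y f].
  by apply: is_iso_comp; [exact: is_iso_fmap (ni_iso e _) | exact: ni_iso].
have En := congr1 (fmap (fiter k F)) (ni_nat e (fmap (fiter k G) f)).
rewrite !fmapM in En; rewrite -compA; apply: etrans (congr1 (comp _) En) _.
rewrite !compA; congr (_ ∘ _); exact: (ni_nat (fiter_comm F k)).
Qed.
End Iterates.

Section ShiftPowers.
Variable C : tricat.

Lemma shiftz_inv (i : int) : nat_iso (fid C) (fcomp (shiftz C i) (shiftz C (- i))).
Proof.
case: i => [[|k]|k].
- exact: (fiter_inv 0 (nat_iso_sym shift_counit)).
- exact: (fiter_inv k.+1 (nat_iso_sym shift_counit)).
exact: (fiter_inv k.+1 shift_unit).
Qed.

Lemma cohom_shiftz (A : abcat) (H : cofunctor C A) i :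
  cohomological H -> cohomological (ccomp H (shiftz C i)).
Proof.
have hS (F : functor C C) k : (forall H' : cofunctor C A,
    cohomological H' -> cohomological (ccomp H' F)) ->
  forall H' : cofunctor C A, cohomological H' -> cohomological (ccomp H' (fiter k F)).
  move=> hF; elim: k => // k IH H' cH'; exact: IH (hF _ cH').
case: i => k; apply: hS; [exact: cohom_shift | exact: cohom_unshift].
Qed.

Lemma in_shift_shiftz (P : C -> Prop) i j X :
  in_shift P i X -> in_shift P (i + j) (shiftz C j X).
Proof.
move=> PX; elim/int_ind: j => [|n IH|n IH]; first by rewrite addr0.
  have -> : i + n.+1%:Z = i + n%:Z + 1 by lia.
  exact: in_shiftS IH.
have -> : - n.+1%:Z = - n%:Z - 1 by lia.
rewrite addrA; apply: in_shift_isom (in_shiftU IH); apply: isom_sym.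
exact: unshift_shiftz.
Qed.

Lemma cofunctor_iso_shiftz (A : abcat) (H : cofunctor C A) i :
  cofunctor_iso (ccomp (ccomp H (shiftz C i)) (shiftz C (- i))) H.
Proof.
have e := shiftz_inv i; exists (fun X => cmap H (e X)); split=> [X|X Y f].
  have [g [ge eg]] := ni_iso e X; exists (cmap H g).
  have := congr1 (cmap H) ge; have := congr1 (cmap H) eg.
  by rewrite !cmapM !cmap1.
by have := congr1 (cmap H) (ni_nat e f); rewrite !cmapM.
Qed.

Lemma ccomp_iso (A : precat) (F G : cofunctor C A) (S : functor C C) :
  cofunctor_iso F G -> cofunctor_iso (ccomp F S) (ccomp G S).
Proof.
move=> [a [ai an]]; exists (fun X => a (S X)).
by split=> [X|X Y f]; [exact: ai | exact: an].
Qed.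

Lemma weight_range_shiftz (w : weight_structure C) (A : abcat)
    (H : cofunctor C A) m n i :
  weight_range w H m n -> weight_range w (ccomp H (shiftz C (- i))) (m + i) (n + i).
Proof.
move=> [Hm Hn]; split=> X wX; [apply: Hm|apply: Hn].
  by have := in_shift_shiftz (- i) wX; rewrite addrAC addrK.
by have := in_shift_shiftz (- i) wX; rewrite addrAC addrK.
Qed.
End ShiftPowers.

Lemma pure_functors_range (C : tricat) (w : weight_structure C) (D : wd_choice w)
    (E : wcone_choice D) (A : abcat) (G : cofunctor C A) (m : int) :
  (cohomological G /\ weight_range w G m m) <->
  exists F : cofunctor (heart w) A,
    cofunctor_iso G (ccomp (pure_functor E F) (shiftz C (- m))).
Proof.
split=> [[cG rG]|[F /cofunctor_iso_sym iG]].
  (* Shifting by [m] reduces to range [[0,0]]; the additive functor sought is the restriction of [K]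
     to the heart. *)
  pose K := ccomp G (shiftz C m).
  have rK : weight_range w K 0 0.
    have := weight_range_shiftz (- m) rG; rewrite opprK addrN.
    by [].
  exists (ccomp K (heart_incl w)); apply: cofunctor_iso_sym.
  apply: cofunctor_iso_trans (cofunctor_iso_shiftz G m).
  apply: ccomp_iso; exact: pure_res_iso (cohom_shiftz m cG) rK.
have [r1 r2] := weight_range_shiftz m (pure_range E F); rewrite add0r in r1 r2.
split; last by split; exact: cofunctor_iso_kills iG _.
by apply: (cofunctor_iso_cohomological iG); apply: cohom_shiftz; exact: pure_cohomological.
Qed.

Lemma representable_range (C : tricat) (w : weight_structure C) (D : wd_choice w)
    (M : C) (m : int) : weight_range_ge w (representable M) m <-> wge w m M.
Proof.
split=> [hM|gM X lX]; last first.
  apply: zero_obj_idm; apply: abhomP => u.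
  exact: w_orthz (u : Hom X M) lX gM (ltz_pred m).
apply: (wge_orth D) => Y f lY.
have [h _] := hM Y lY.
exact: (congr1 (fun t : abhom _ _ => abhom_fun t f) (h _ (idm _))).
Qed.

Theorem proposition2p4p4 (C : tricat) (w : weight_structure C)
    (D : wd_choice w) (E : wcone_choice D) (A : abcat)
    (H : cofunctor C A) (hH : cohomological H) (m n : int) (M : C) :
  (* 1 *)
  (weight_range_le w (tau_ge D H n) n /\ weight_range_ge w (tau_le D H m) m)
  /\ (* 2 *)
  (bounded w ->
     (weight_range_le w H n <-> forall i : int, n < i -> kills H (weq w i)) /\
     (weight_range_ge w H m <-> forall i : int, i < m -> kills H (weq w i)))
  /\ (* 3 *)
  ((cofunctor_iso (tau_ge D H n) H <-> weight_range_le w H n) /\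
     (cofunctor_iso (tau_le D H m) H <-> weight_range_ge w H m))
  /\ (* 4 *)
  cofunctor_iso (tau_ge D (tau_le D H m) n) (tau_le D (tau_ge D H n) m)
  /\ (* 5 *)
  (weight_range_ge w H m -> weight_range w (tau_ge D H n) m n)
  /\ (* 6 *)
  (weight_range_le w H n -> weight_range w (tau_le D H m) m n)
  /\ (* 7 *)
  (n < m ->
     (forall G : cofunctor C A, cohomological G ->
        weight_range w G m n -> cofunctor_zero G) /\
     (weight_range_le w H n -> cofunctor_zero (tau_le D H m)) /\
     (weight_range_ge w H m -> cofunctor_zero (tau_ge D H n)))
  /\ (* 8 *)
  (forall G : cofunctor C A,
     (cohomological G /\ weight_range w G m m) <->
     exists F : cofunctor (heart w) A,
       cofunctor_iso G (ccomp (pure_functor E F) (shiftz C (- m))))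
  /\ (* 9 *)
  (weight_range_ge w (representable M) m <-> wge w m M)
  /\ (* 10 *)
  (weight_range w H m n ->
     (forall d : wdec w (m - 1) M, epi (cmap H (wrb d))) /\
     (forall d : wdec w n M, mono (cmap H (wla d)))).
Proof.
have iso_ge : cofunctor_iso (tau_ge D H n) H <-> weight_range_le w H n.
  split=> [i|Hn]; first by apply: (cofunctor_iso_kills i); exact: tau_ge_range.
  exact/cofunctor_iso_sym/tau_ge_iso.
have iso_le : cofunctor_iso (tau_le D H m) H <-> weight_range_ge w H m.
  split=> [i|Hm]; first by apply: (cofunctor_iso_kills i); exact: tau_le_range.
  exact: tau_le_iso.
split; first by split; [exact: tau_ge_range | exact: tau_le_range].
split; first by move=> bw; split; [exact: bounded_range_le | exact: bounded_range_ge].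
split; first by [].
split; first exact: tau_commute.
split; first by move=> Hm; split; [exact: tau_ge_range_ge | exact: tau_ge_range].
split; first by move=> Hn; split; [exact: tau_le_range | exact: tau_le_range_le].
split.
  move=> nm; split; first by move=> G cG; exact: weight_range_zero.
  by split; [exact: tau_le_trunc_zero | exact: tau_ge_trunc_zero].
split; first by move=> G; exact: pure_functors_range.
split; first exact: representable_range.
by move=> [Hm Hn]; split=> d; [exact: weight_range_epi | exact: weight_range_mono].
Qed.
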